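(* Let $T>0$, $0<\eta<T$, $0<\alpha <\frac{2T}{\eta ^{2}}$ and $0\leq\beta < \frac{2T-\alpha \eta ^{2}}{\alpha \eta ^{2}-2\eta +2T}$. Assume $f\in C([0,\infty),[0,\infty))$, and $a\in C([0,T],[0,\infty))$ with $a(t_0)>0$ for some $t_{0}\in[\eta,T]$. Let \[ f_{0}=\lim_{u\rightarrow0^{+}}\frac{f(u)}{u},\qquad f_{\infty}=\lim_{u\rightarrow\infty}\frac{f(u)}{u}. \] Then the boundary value problem \[ u''(t)+a(t)f(u(t))=0,\ 0<t<T,\qquad u(0)=\beta u(\eta),\quad u(T)=\alpha\int_{0}^{\eta}u(s)\,ds \] has at least one positive solution in each of the following cases: (i) $f_{0}=0$ and $f_{\infty}=\infty$ (superlinear case); (ii) $f_{0}=\infty$ and $f_{\infty}=0$ (sublinear case).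
   Context: A solution is a function $u\in C^2([0,T])$ satisfying the differential equation on $(0,T)$ and the boundary conditions; a positive solution is a solution $u$ with $u(t)>0$ for $0<t<T$. The limits defining $f_0$ and $f_\infty$ are assumed to exist (possibly infinite) with the stated values. *)

(* Defs.v *)
From Stdlib Require Import Reals.
From Coquelicot Require Import Coquelicot.
Open Scope R_scope.

Definition cont_within (D : R -> Prop) (g : R -> R) (t : R) : Prop :=
  filterlim g (within D (locally t)) (locally (g t)).

Definition Icc (a b : R) (x : R) : Prop := a <= x <= b.

(* u in C^2([0,T]): u is twice differentiable on (0,T), and u, u', u''
   extend continuously to [0,T] (u1, u2 give these extensions). *)
Definition C2_on (T : R) (u u1 u2 : R -> R) : Prop :=
  (forall t, 0 < t < T -> is_derive u t (u1 t) /\ is_derive u1 t (u2 t)) /\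
  (forall t, 0 <= t <= T ->
     cont_within (Icc 0 T) u t /\ cont_within (Icc 0 T) u1 t /\
     cont_within (Icc 0 T) u2 t).

Definition positive_solution (T eta alpha beta : R) (a f : R -> R)
    (u : R -> R) : Prop :=
  exists u1 u2 : R -> R,
    C2_on T u u1 u2 /\
    (forall t, 0 < t < T -> u2 t + a t * f (u t) = 0) /\
    u 0 = beta * u eta /\
    u T = alpha * RInt u 0 eta /\
    (forall t, 0 < t < T -> 0 < u t).

(* Main.v *)
Require Import Defs.
From Stdlib Require Import Reals Lra Lia Bool Classical ClassicalEpsilon.
From Coquelicot Require Import Coquelicot.
From mathcomp Require filter.
Open Scope R_scope.

(* Write [u t = p + q t - int_0^t int_0^r a f(u)]: a solution is determined by
   the initial data [(p, q)], and the two boundary conditions are two equations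
   in the plane. With [y := (1 - alpha eta) p + (T - alpha eta^2 / 2) q] they
   say that [(p, y)] is a fixed point of the planar map
     (p, y) |-> (beta max(u eta, 0), y - u T + alpha int_0^eta u),
   which preserves the quadrant [p, y >= 0] because [u] is concave. The growth
   of [f] at [0] and at infinity makes this map compressive or expansive on the
   segments [p + y = r] for small and for large [r], so a two-dimensional
   Krasnoselskii theorem, proved with Sperner's parity argument, yields a fixed
   point with [p + y] bounded away from [0].

   As [f] is only continuous, initial value problems need not be well posed;
   [f (u s)] is therefore replaced by [f (u (max 0 (s - e)))], for which
   they are, and [e] tends to [0] by Arzela-Ascoli. *)

(** * Compactness along an ultrafilter *)

(** Both parameter hypotheses are sign conditions on the boundary problem for affine functions
    [p + q t]. The bound [alpha eta^2 < 2 T] makes the coefficient [kappa] of [q] in [y] positive,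
    so that [y] can replace [q] as a coordinate; the bound on [beta] makes the determinant of the
    two boundary conditions positive, which bounds [p] by a multiple of [y] for subsolutions.
    Compression and expansion are stated as the absence of sub- and supersolutions of size
    [p + y = s], because each such pair of inequalities turns into an a priori estimate. The size of
    a subsolution is at most a multiple of the bound on its forcing. A supersolution is nonnegative
    and concave, hence comparable with its maximum away from the endpoints, so a large ratio
    [f x / x] would push its value at an interior point above itself. These estimates hold with the
    same radii for all small delays, so the bound [p + y >= r] survives the limit; it is what
    excludes the zero solution. *)

Record ultra (U : (nat -> Prop) -> Prop) : Prop := Ultra {
  ultra_filter : ProperFilter U;
  ultra_dec : forall P, U P \/ U (fun n => ~ P n);
  ultra_ev : forall P, eventually P -> U P }.

Lemma ultrafilter_on_nat : exists U, ultra U.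
Proof.
  destruct (@filter.ultraFilterLemma nat eventually) as [U [HU Hsub]].
  { apply filter.Build_ProperFilter.
    - intros [N HN]. exact (HN N (le_n N)).
    - constructor.
      + exists 0%nat. intros n _. exact I.
      + intros P Q. exact (@filter_and _ eventually _ P Q).
      + intros P Q HPQ. exact (@filter_imp _ eventually _ P Q HPQ). }
  exists U.
  pose proof (@filter.ultra_proper _ _ HU) as HP.
  pose proof (@filter.filter_filter _ _ HP) as HF.
  constructor.
  - constructor.
    + intros P HUP. apply NNPP. intros Hno.
      apply (@filter.filter_not_empty _ _ HP).
      refine (@filter.filterS _ _ HF _ _ _ HUP). intros n Hn. exact (Hno (ex_intro _ n Hn)).
    + constructor.
      * exact (@filter.filterT _ U HF).
      * intros P Q. exact (@filter.filterI _ U HF P Q).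
      * intros P Q HPQ. exact (@filter.filterS _ U HF P Q HPQ).
  - intros P. exact (@filter.in_ultra_setVsetC _ U P HU).
  - exact Hsub.
Qed.

Lemma ultra_and U (hU : ultra U) (P Q : nat -> Prop) :
  U P -> U Q -> U (fun n => P n /\ Q n).
Proof. destruct hU as [F _ _]. apply filter_and. Qed.

Lemma ultra_imp U (hU : ultra U) (P Q : nat -> Prop) :
  (forall n, P n -> Q n) -> U P -> U Q.
Proof. destruct hU as [F _ _]. apply filter_imp. Qed.

Lemma ultra_ex U (hU : ultra U) (P : nat -> Prop) : U P -> exists n, P n.
Proof. destruct hU as [F _ _]. apply filter_ex. Qed.

(** Along one fixed ultrafilter all bounded sequences converge at once, so uncountably many limits
    can be taken without extracting subsequences. *)
Lemma ultra_bounded_lim U (hU : ultra U) (x : nat -> R) (m M : R) :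
  (forall n, m <= x n <= M) ->
  exists l, m <= l <= M /\ forall e, 0 < e -> U (fun n => Rabs (x n - l) < e).
Proof.
  intros Hx.
  assert (Hall : forall P : nat -> Prop, (forall n, P n) -> U P).
  { intros P HP. apply (ultra_ev _ hU). exists 0%nat. intros n _. apply HP. }
  (* The limit is the supremum of the lower bounds valid on a set of the ultrafilter; [ultra_dec]
     turns a failed estimate on either side into a bound contradicting this supremum. *)
  destruct (completeness (fun y => U (fun n => y <= x n))) as [l [Hub Hlub]].
  - exists M. intros y Hy. destruct (ultra_ex _ hU _ Hy) as [n Hn].
    specialize (Hx n). lra.
  - exists m. apply Hall. intros n. apply Hx.
  - assert (Hl : m <= l <= M).
    { split.
      - apply Hub. apply Hall. intros n. apply Hx.
      - apply Hlub. intros y Hy. destruct (ultra_ex _ hU _ Hy) as [n Hn].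
        specialize (Hx n). lra. }
    exists l. split; [exact Hl|]. intros e He.
    assert (H1 : U (fun n => l - e < x n)).
    { destruct (ultra_dec _ hU (fun n => l - e < x n)) as [H|H]; [exact H|].
      exfalso.
      assert (l <= l - e); [|lra].
      apply Hlub. intros y Hy. apply Rnot_lt_le. intros Hlt.
      destruct (ultra_ex _ hU _ (ultra_and _ hU _ _ H Hy)) as [n Hn]. lra. }
    assert (H2 : U (fun n => x n < l + e)).
    { destruct (ultra_dec _ hU (fun n => x n < l + e)) as [H|H]; [exact H|].
      exfalso.
      assert (l + e <= l); [|lra].
      apply Hub. revert H. apply (ultra_imp _ hU). intros n Hn. lra. }
    generalize (ultra_and _ hU _ _ H1 H2). apply (ultra_imp _ hU).
    intros n [Ha Hb]. apply Rabs_def1; lra.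
Qed.

Lemma square_cluster (P : nat -> R -> R -> Prop) :
  (forall n, exists x y, 0 <= x <= 1 /\ 0 <= y <= 1 /\ P n x y) ->
  exists x y, 0 <= x <= 1 /\ 0 <= y <= 1 /\
    forall e N, 0 < e -> exists n x' y', (N <= n)%nat /\ P n x' y' /\
      Rabs (x' - x) < e /\ Rabs (y' - y) < e.
Proof.
  intros H. destruct ultrafilter_on_nat as [U hU].
  assert (Hz : forall n, exists z : R * R,
    0 <= fst z <= 1 /\ 0 <= snd z <= 1 /\ P n (fst z) (snd z)).
  { intros n. destruct (H n) as [x [y Hxy]]. exists (x, y). exact Hxy. }
  set (z := fun n => proj1_sig (constructive_indefinite_description _ (Hz n))).
  assert (Pz : forall n, 0 <= fst (z n) <= 1 /\ 0 <= snd (z n) <= 1 /\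
                 P n (fst (z n)) (snd (z n))).
  { intros n. unfold z. apply proj2_sig. }
  destruct (ultra_bounded_lim U hU (fun n => fst (z n)) 0 1) as [x [Hx Lx]];
    [intros n; apply Pz|].
  destruct (ultra_bounded_lim U hU (fun n => snd (z n)) 0 1) as [y [Hy Ly]];
    [intros n; apply Pz|].
  exists x, y. split; [exact Hx|]. split; [exact Hy|].
  intros e N He.
  assert (HN : U (fun n => (N <= n)%nat)).
  { apply (ultra_ev _ hU). exists N. auto. }
  destruct (ultra_ex _ hU _ (ultra_and _ hU _ _ HN
              (ultra_and _ hU _ _ (Lx e He) (Ly e He)))) as [n [H1 [H2 H3]]].
  exists n, (fst (z n)), (snd (z n)). repeat split; auto. apply Pz.
Qed.

(** * Zeros of planar maps *)

Fixpoint xor_sum (b : nat -> bool) (n : nat) : bool :=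
  match n with O => false | S m => xorb (xor_sum b m) (b m) end.

Definition crossing (pos bp : nat -> nat -> bool) i j k l : bool :=
  bp i j && bp k l && xorb (pos i j) (pos k l).

(* Sperner's parity argument: if no unit square sees both values of [pos] and
   both values of [bp], the parity of the number of sign changes of [pos]
   along [bp] is the same in all rows; but it is odd in the bottom row and
   even in the top row. *)
Lemma grid_crossing (pos bp : nat -> nat -> bool) (n : nat)
  (hl : forall j, pos 0%nat j = true) (hr : forall j, pos n j = false)
  (hb : forall i, (i < n)%nat -> pos i 0%nat <> pos (S i) 0%nat ->
     bp i 0%nat = true /\ bp (S i) 0%nat = true)
  (ht : forall i, (i < n)%nat -> pos i n <> pos (S i) n ->
     bp i n = false \/ bp (S i) n = false) :
  exists i j, (i < n)%nat /\ (j < n)%nat /\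
    (exists k l, (i <= k <= S i)%nat /\ (j <= l <= S j)%nat /\ pos k l = true) /\
    (exists k l, (i <= k <= S i)%nat /\ (j <= l <= S j)%nat /\ pos k l = false) /\
    (exists k l, (i <= k <= S i)%nat /\ (j <= l <= S j)%nat /\ bp k l = true) /\
    (exists k l, (i <= k <= S i)%nat /\ (j <= l <= S j)%nat /\ bp k l = false).
Proof.
  apply NNPP. intros Hno.
  (* The boundary of a unit square carries an even number of crossings. If [bp] is true at all
     corners, they are the sign changes of [pos] around a closed loop; in the other unmixed cases
     there are none. *)
  assert (Hsq : forall i j, (i < n)%nat -> (j < n)%nat ->
    xorb (crossing pos bp i j (S i) j) (crossing pos bp i (S j) (S i) (S j)) =
    xorb (crossing pos bp i j i (S j)) (crossing pos bp (S i) j (S i) (S j))).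
  { intros i j Hi Hj.
    assert (Hmix : forall (b : nat -> nat -> bool) v,
      (b i j = negb v /\ b i (S j) = negb v /\ b (S i) j = negb v /\
         b (S i) (S j) = negb v) \/
      (exists k l, (i <= k <= S i)%nat /\ (j <= l <= S j)%nat /\ b k l = v)).
    { intros b v. destruct (classic (exists k l, (i <= k <= S i)%nat /\
        (j <= l <= S j)%nat /\ b k l = v)) as [H|H]; [now right|left].
      assert (Hn : forall k l, (i <= k <= S i)%nat -> (j <= l <= S j)%nat ->
        b k l = negb v).
      { intros k l Hk Hl. destruct (bool_dec (b k l) v) as [E|E].
        - exfalso. apply H. now exists k, l.
        - revert E. now destruct (b k l), v. }
      rewrite !Hn by lia. auto. }
    unfold crossing.
    destruct (Hmix pos true) as [[-> [-> [-> ->]]]|H1];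
      [simpl; now rewrite !andb_false_r|].
    destruct (Hmix pos false) as [[-> [-> [-> ->]]]|H2];
      [simpl; now rewrite !andb_false_r|].
    destruct (Hmix bp true) as [[-> [-> [-> ->]]]|H3]; [reflexivity|].
    destruct (Hmix bp false) as [[-> [-> [-> ->]]]|H4];
      [now destruct (pos i j), (pos i (S j)), (pos (S i) j), (pos (S i) (S j))|].
    exfalso. apply Hno. exists i, j. auto 10. }
  assert (Hrow : forall j, (j < n)%nat ->
    xor_sum (fun i => crossing pos bp i j (S i) j) n =
    xor_sum (fun i => crossing pos bp i (S j) (S i) (S j)) n).
  { intros j Hj.
    (* Summing over the first [m] squares of a strip leaves only the vertical edge in column [m]. It
       is no crossing in columns [0] and [n], where [pos] is constant. *)
    assert (Hm : forall m, (m <= n)%nat ->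
      xorb (xor_sum (fun i => crossing pos bp i j (S i) j) m)
           (xor_sum (fun i => crossing pos bp i (S j) (S i) (S j)) m) =
      crossing pos bp m j m (S j)).
    { induction m as [|m IH]; intros Hm; simpl.
      - unfold crossing. rewrite !hl. now destruct (bp 0%nat j), (bp 0%nat (S j)).
      - specialize (IH ltac:(lia)). specialize (Hsq m j ltac:(lia) Hj).
        revert IH Hsq.
        generalize (xor_sum (fun i => crossing pos bp i j (S i) j) m),
          (xor_sum (fun i => crossing pos bp i (S j) (S i) (S j)) m),
          (crossing pos bp m j (S m) j), (crossing pos bp m (S j) (S m) (S j)),
          (crossing pos bp m j m (S j)), (crossing pos bp (S m) j (S m) (S j)).
        intros [] [] [] [] [] []; simpl; congruence. }
    specialize (Hm n (le_n n)). revert Hm.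
    unfold crossing at 3. rewrite !hr. rewrite xorb_nilpotent, andb_false_r.
    apply xorb_eq. }
  assert (Hall : forall j, (j <= n)%nat ->
    xor_sum (fun i => crossing pos bp i 0 (S i) 0) n =
    xor_sum (fun i => crossing pos bp i j (S i) j) n).
  { induction j as [|j IH]; intros Hj; [reflexivity|].
    rewrite IH by lia. apply Hrow. lia. }
  specialize (Hall n (le_n n)).
  (* In the bottom row every sign change is a crossing, so the parity records whether [pos] has left
     its initial value [true]. *)
  assert (Hbot : forall m, (m <= n)%nat ->
    xor_sum (fun i => crossing pos bp i 0 (S i) 0) m = negb (pos m 0%nat)).
  { induction m as [|m IH]; intros Hm; simpl.
    - now rewrite hl.
    - rewrite IH by lia. unfold crossing.
      specialize (hb m ltac:(lia)). revert hb.
      destruct (pos m 0%nat), (pos (S m) 0%nat); intros hb;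
        try (destruct hb as [-> ->]; [discriminate|reflexivity]);
        simpl; now rewrite andb_false_r. }
  assert (Htop : forall m, (m <= n)%nat ->
    xor_sum (fun i => crossing pos bp i n (S i) n) m = false).
  { induction m as [|m IH]; intros Hm; simpl; [reflexivity|].
    rewrite IH by lia. unfold crossing.
    specialize (ht m ltac:(lia)). revert ht.
    destruct (pos m n), (pos (S m) n); intros ht;
      try (destruct ht as [-> | ->]; [discriminate| |]);
      simpl; now rewrite ?andb_false_r. }
  rewrite Hbot, Htop, hr in Hall by lia. discriminate.
Qed.

Lemma continuity_2d_nonneg (f : R -> R -> R) x y :
  continuity_2d_pt f x y ->
  (forall e, 0 < e -> exists x' y',
     Rabs (x' - x) < e /\ Rabs (y' - y) < e /\ 0 <= f x' y') ->
  0 <= f x y.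
Proof.
  intros Hc H. apply Rnot_lt_le. intros Hlt.
  destruct (Hc (mkposreal (- f x y) ltac:(lra))) as [d Hd].
  destruct (H d (cond_pos d)) as [x' [y' [Hx [Hy Hf]]]].
  specialize (Hd x' y' Hx Hy). simpl in Hd.
  apply Rabs_def2 in Hd. lra.
Qed.

Lemma continuity_2d_nonpos (f : R -> R -> R) x y :
  continuity_2d_pt f x y ->
  (forall e, 0 < e -> exists x' y',
     Rabs (x' - x) < e /\ Rabs (y' - y) < e /\ f x' y' <= 0) ->
  f x y <= 0.
Proof.
  intros Hc H.
  assert (0 <= - f x y); [|lra].
  apply (continuity_2d_nonneg (fun x y => - f x y)).
  - now apply continuity_2d_pt_opp.
  - intros e He. destruct (H e He) as [x' [y' [Hx [Hy Hf]]]].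
    exists x', y'. repeat split; auto; lra.
Qed.

Lemma INR_ratio_bounds i n : (i <= S n)%nat -> 0 <= INR i / INR (S n) <= 1.
Proof.
  intros Hi. assert (0 < INR (S n)) by (apply lt_0_INR; lia).
  apply le_INR in Hi. pose proof (pos_INR i). split.
  - apply Rle_mult_inv_pos; lra.
  - apply Rle_div_l; lra.
Qed.

Lemma INR_ratio_near i k n : (i <= k <= S i)%nat ->
  Rabs (INR k / INR (S n) - INR i / INR (S n)) <= / INR (S n).
Proof.
  intros [H1 H2]. assert (0 < INR (S n)) by (apply lt_0_INR; lia).
  apply le_INR in H1. apply le_INR in H2. rewrite (S_INR i) in H2.
  replace (INR k / INR (S n) - INR i / INR (S n))
    with ((INR k - INR i) * / INR (S n)) by (field; lra).
  pose proof (Rinv_0_lt_compat _ H).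
  rewrite Rabs_mult, (Rabs_pos_eq (/ INR (S n))), Rabs_pos_eq by lra. nra.
Qed.

(* A form of the Poincare-Miranda theorem; on the two horizontal sides the
   sign of [B] is only prescribed at the zeros of [A]. *)
Lemma square_zero (A B : R -> R -> R)
  (hA : forall x y, continuity_2d_pt A x y)
  (hB : forall x y, continuity_2d_pt B x y)
  (hl : forall y, 0 <= y <= 1 -> 0 <= A 0 y)
  (hr : forall y, 0 <= y <= 1 -> A 1 y <= 0)
  (hb : forall x, 0 <= x <= 1 -> A x 0 = 0 -> 0 < B x 0)
  (ht : forall x, 0 <= x <= 1 -> A x 1 = 0 -> B x 1 < 0) :
  exists x y, 0 <= x <= 1 /\ 0 <= y <= 1 /\ A x y = 0 /\ B x y = 0.
Proof.
  set (near := fun (n : nat) x y (Q : R -> R -> Prop) => exists x' y',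
    Rabs (x' - x) <= / INR (S n) /\ Rabs (y' - y) <= / INR (S n) /\ Q x' y').
  (* An approximate zero at mesh [1 / (n + 1)]. On a horizontal side one sign of [B] is not
     recorded, because [hb] or [ht] supplies it once [A] vanishes in the limit. *)
  set (P := fun (n : nat) x y =>
    near n x y (fun x' y' => 0 <= A x' y') /\
    near n x y (fun x' y' => A x' y' <= 0) /\
    (y = 0 \/ near n x y (fun x' y' => 0 <= B x' y')) /\
    (y = 1 \/ near n x y (fun x' y' => B x' y' <= 0))).
  destruct (square_cluster P) as [x [y [Hx [Hy Hz]]]].
  - intros n.
    set (r := fun i => INR i / INR (S n)).
    assert (Hn : 0 < INR (S n)) by (apply lt_0_INR; lia).
    assert (r0 : r 0%nat = 0) by (unfold r; simpl INR at 1; lra).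
    assert (r1 : r (S n) = 1) by (unfold r; field; lra).
    (* On the vertical sides [pos] is prescribed rather than read off from [A], which may vanish
       there; [hl] and [hr] keep the weak inequalities below true. *)
    set (pos := fun i j => if Nat.eq_dec i 0 then true else
                  if Nat.eq_dec i (S n) then false else
                  if Rlt_dec 0 (A (r i) (r j)) then true else false).
    set (bp := fun i j => if Rlt_dec 0 (B (r i) (r j)) then true else false).
    assert (pos_t : forall i j, (i <= S n)%nat -> (j <= S n)%nat ->
              pos i j = true -> 0 <= A (r i) (r j)).
    { intros i j Hi Hj. unfold pos.
      destruct Nat.eq_dec as [->|_].
      { intros _. rewrite r0. apply hl. now apply INR_ratio_bounds. }
      destruct Nat.eq_dec; [discriminate|].
      destruct Rlt_dec; [lra|discriminate]. }
    assert (pos_f : forall i j, (i <= S n)%nat -> (j <= S n)%nat ->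
              pos i j = false -> A (r i) (r j) <= 0).
    { intros i j Hi Hj. unfold pos.
      destruct Nat.eq_dec as [->|_]; [discriminate|].
      destruct Nat.eq_dec as [->|_].
      { intros _. rewrite r1. apply hr. now apply INR_ratio_bounds. }
      destruct Rlt_dec; [discriminate|lra]. }
    assert (bp_t : forall i j, bp i j = true -> 0 <= B (r i) (r j)).
    { intros i j. unfold bp. destruct Rlt_dec; [lra|discriminate]. }
    assert (bp_f : forall i j, bp i j = false -> B (r i) (r j) <= 0).
    { intros i j. unfold bp. destruct Rlt_dec; [discriminate|lra]. }
    assert (mk : forall i j k l (Q : R -> R -> Prop), (i <= k <= S i)%nat ->
              (j <= l <= S j)%nat -> Q (r k) (r l) -> near n (r i) (r j) Q).
    { intros i j k l Q Hk Hl HQ. exists (r k), (r l).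
      repeat split; auto; now apply INR_ratio_near. }
    assert (mkA : forall i j, (i < S n)%nat -> (j <= S n)%nat ->
      pos i j <> pos (S i) j ->
      near n (r i) (r j) (fun x' y' => 0 <= A x' y') /\
      near n (r i) (r j) (fun x' y' => A x' y' <= 0)).
    { intros i j Hi Hj.
      destruct (pos i j) eqn:E1, (pos (S i) j) eqn:E2; intros NE;
        try congruence; split.
      - apply (mk i j i j); try lia. apply pos_t; auto; lia.
      - apply (mk i j (S i) j); try lia. apply pos_f; auto; lia.
      - apply (mk i j (S i) j); try lia. apply pos_t; auto; lia.
      - apply (mk i j i j); try lia. apply pos_f; auto; lia. }
    (* A bottom edge violating the hypothesis of [grid_crossing] already satisfies [P] with [y = 0];
       the same holds on the top row with [y = 1]. Only if neither occurs is the parity argument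
       needed. *)
    destruct (classic (exists i, (i < S n)%nat /\ pos i 0%nat <> pos (S i) 0%nat /\
       (bp i 0%nat = false \/ bp (S i) 0%nat = false))) as [[i [Hi [Hp Hq]]]|Nb].
    { exists (r i), 0. split; [apply INR_ratio_bounds; lia|]. split; [lra|].
      destruct (mkA i 0%nat Hi ltac:(lia) Hp) as [H1 H2].
      rewrite <- r0. repeat split; auto. right.
      destruct Hq as [Hq|Hq].
      - apply (mk i 0%nat i 0%nat); try lia. now apply bp_f.
      - apply (mk i 0%nat (S i) 0%nat); try lia. now apply bp_f. }
    destruct (classic (exists i, (i < S n)%nat /\ pos i (S n) <> pos (S i) (S n) /\
       (bp i (S n) = true /\ bp (S i) (S n) = true))) as [[i [Hi [Hp [Hq _]]]]|Nt].
    { exists (r i), 1. split; [apply INR_ratio_bounds; lia|]. split; [lra|].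
      destruct (mkA i (S n) Hi ltac:(lia) Hp) as [H1 H2].
      rewrite <- r1. repeat split; auto. right.
      apply (mk i (S n) i (S n)); try lia. now apply bp_t. }
    assert (Hb0 : forall i, (i < S n)%nat -> pos i 0%nat <> pos (S i) 0%nat ->
              bp i 0%nat = true /\ bp (S i) 0%nat = true).
    { intros i Hi Hp. apply NNPP. intros H. apply Nb. exists i.
      split; [auto|]. split; [auto|].
      destruct (bp i 0%nat), (bp (S i) 0%nat); auto; exfalso; auto. }
    assert (Ht0 : forall i, (i < S n)%nat -> pos i (S n) <> pos (S i) (S n) ->
              bp i (S n) = false \/ bp (S i) (S n) = false).
    { intros i Hi Hp. apply NNPP. intros H. apply Nt. exists i.
      split; [auto|]. split; [auto|].
      destruct (bp i (S n)), (bp (S i) (S n)); auto; exfalso; auto. }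
    assert (Hr0 : forall j, pos (S n) j = false).
    { intros j. unfold pos. simpl. now destruct Nat.eq_dec. }
    destruct (grid_crossing pos bp (S n) (fun j => eq_refl) Hr0 Hb0 Ht0) as
      [i [j [Hi [Hj [[k1 [l1 [K1 [L1 E1]]]] [[k2 [l2 [K2 [L2 E2]]]]
         [[k3 [l3 [K3 [L3 E3]]]] [k4 [l4 [K4 [L4 E4]]]]]]]]]]].
    exists (r i), (r j).
    split; [apply INR_ratio_bounds; lia|].
    split; [apply INR_ratio_bounds; lia|]. repeat split.
    + apply (mk i j k1 l1); auto. apply pos_t; auto; lia.
    + apply (mk i j k2 l2); auto. apply pos_f; auto; lia.
    + right. apply (mk i j k3 l3); auto.
    + right. apply (mk i j k4 l4); auto.
  (* The pair [v], [z] supplies a radius around [y] within which points of the exceptional side are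
     excluded. The conditions on [A] have no exceptional side, and [0], [1] are dummies there. *)
  - assert (Hcl : forall (Q : R -> R -> Prop) (v : R) (z : R), z <> v ->
       (forall n x' y', P n x' y' -> (Rabs (y' - y) < Rabs (z - v) -> False) \/
           near n x' y' Q) ->
       forall e, 0 < e -> exists x' y', Rabs (x' - x) < e /\ Rabs (y' - y) < e /\ Q x' y').
    { intros Q v z Hv HQ e He.
      assert (Hd : 0 < Rmin (e / 2) (Rabs (z - v))).
      { apply Rmin_pos; [lra|]. apply Rabs_pos_lt. lra. }
      destruct (archimed_cor1 (e / 2) ltac:(lra)) as [N [HN HN0]].
      destruct (Hz (Rmin (e / 2) (Rabs (z - v))) N Hd)
        as [n [x' [y' [Hn [HP [Hx' Hy']]]]]].
      pose proof (Rmin_l (e / 2) (Rabs (z - v))).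
      pose proof (Rmin_r (e / 2) (Rabs (z - v))).
      destruct (HQ _ _ _ HP) as [H'|[x'' [y'' [Hx'' [Hy'' H']]]]];
        [exfalso; apply H'; lra|].
      assert (Hi : / INR (S n) <= / INR N).
      { apply Rinv_le_contravar; [now apply lt_0_INR|]. apply le_INR. lia. }
      exists x'', y''. repeat split; auto.
      - replace (x'' - x) with ((x'' - x') + (x' - x)) by ring.
        eapply Rle_lt_trans; [apply Rabs_triang|]. lra.
      - replace (y'' - y) with ((y'' - y') + (y' - y)) by ring.
        eapply Rle_lt_trans; [apply Rabs_triang|]. lra. }
    assert (HA : A x y = 0).
    { apply Rle_antisym.
      - apply continuity_2d_nonpos; [apply hA|].
        apply (Hcl _ 0 1); [lra|]. intros n x' y' HP. right. apply HP.
      - apply continuity_2d_nonneg; [apply hA|].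
        apply (Hcl _ 0 1); [lra|]. intros n x' y' HP. right. apply HP. }
    exists x, y. repeat split; try tauto; try lra.
    apply Rle_antisym.
    + destruct (Req_dec y 1) as [->|Hy1].
      { left. now apply ht. }
      apply continuity_2d_nonpos; [apply hB|].
      apply (Hcl _ 1 y); [lra|]. intros n x' y' [_ [_ [_ [->|HP]]]]; [|now right].
      left. rewrite Rabs_minus_sym. lra.
    + destruct (Req_dec y 0) as [->|Hy1].
      { left. now apply hb. }
      apply continuity_2d_nonneg; [apply hB|].
      apply (Hcl _ 0 y); [lra|]. intros n x' y' [_ [_ [[->|HP] _]]]; [|now right].
      left. rewrite Rabs_minus_sym. lra.
Qed.

Lemma continuity_2d_pt_comp2 (f g h : R -> R -> R) x y :
  continuity_2d_pt f (g x y) (h x y) -> continuity_2d_pt g x y ->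
  continuity_2d_pt h x y -> continuity_2d_pt (fun x y => f (g x y) (h x y)) x y.
Proof.
  intros Hf Hg Hh e. destruct (Hf e) as [d Hd].
  destruct (Hg d) as [d1 H1]. destruct (Hh d) as [d2 H2].
  exists (mkposreal _ (Rmin_stable_in_posreal d1 d2)). simpl. intros u v Hu Hv.
  pose proof (Rmin_l d1 d2). pose proof (Rmin_r d1 d2).
  apply Hd; [apply H1|apply H2]; lra.
Qed.

(** * Compression and expansion in the quadrant *)

Definition not_expanding (F G : R -> R -> R) (s : R) : Prop :=
  forall x y, 0 <= x -> 0 <= y -> x + y = s -> x <= F x y -> y <= G x y -> False.

Definition not_contracting (F G : R -> R -> R) (s : R) : Prop :=
  forall x y, 0 <= x -> 0 <= y -> x + y = s -> F x y <= x -> G x y <= y -> False.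

(* Krasnoselskii's cone theorem in the quadrant. In the coordinates
   [x = s (1 - th), y = s th], the pair [(F, G)] is a fixed point iff it is
   parallel to [(x, y)] (first equation) and has the same l1 norm (second). *)
Lemma annulus_fixed_point (F G : R -> R -> R) (r r1 : R)
  (hr : 0 < r < r1)
  (hF : forall x y, continuity_2d_pt F x y)
  (hG : forall x y, continuity_2d_pt G x y)
  (F0 : forall x y, 0 <= x -> 0 <= y -> 0 <= F x y)
  (G0 : forall x y, 0 <= x -> 0 <= y -> 0 <= G x y)
  (H : not_expanding F G r /\ not_contracting F G r1 \/
       not_contracting F G r /\ not_expanding F G r1) :
  exists x y, 0 <= x /\ 0 <= y /\ r <= x + y <= r1 /\ F x y = x /\ G x y = y.
Proof.
  set (s := fun t => r + (r1 - r) * t).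
  set (X := fun th t => s t * (1 - th)).
  set (Y := fun th t => s t * th).
  set (A := fun th t => (1 - th) * G (X th t) (Y th t) - th * F (X th t) (Y th t)).
  set (B := fun th t => s t - (F (X th t) (Y th t) + G (X th t) (Y th t))).
  assert (cs : forall x y, continuity_2d_pt (fun _ t => s t) x y).
  { intros x y. unfold s. apply continuity_2d_pt_plus; [apply continuity_2d_pt_const|].
    apply continuity_2d_pt_mult; [apply continuity_2d_pt_const|apply continuity_2d_pt_id2]. }
  assert (c1 : forall x y, continuity_2d_pt (fun th _ => 1 - th) x y).
  { intros x y. apply continuity_2d_pt_minus;
      [apply continuity_2d_pt_const|apply continuity_2d_pt_id1]. }
  assert (cX : forall x y, continuity_2d_pt X x y).
  { intros x y. apply continuity_2d_pt_mult; [apply cs|apply c1]. }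
  assert (cY : forall x y, continuity_2d_pt Y x y).
  { intros x y. apply continuity_2d_pt_mult; [apply cs|apply continuity_2d_pt_id1]. }
  assert (cF : forall x y, continuity_2d_pt (fun th t => F (X th t) (Y th t)) x y).
  { intros x y. apply continuity_2d_pt_comp2; auto. }
  assert (cG : forall x y, continuity_2d_pt (fun th t => G (X th t) (Y th t)) x y).
  { intros x y. apply continuity_2d_pt_comp2; auto. }
  assert (cA : forall x y, continuity_2d_pt A x y).
  { intros x y. apply continuity_2d_pt_minus; apply continuity_2d_pt_mult; auto.
    apply continuity_2d_pt_id1. }
  assert (cB : forall x y, continuity_2d_pt B x y).
  { intros x y. apply continuity_2d_pt_minus; auto. apply continuity_2d_pt_plus; auto. }
  assert (sp : forall t, 0 <= t <= 1 -> r <= s t <= r1) by (intros t Ht; unfold s; nra).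
  assert (XY : forall th t, X th t + Y th t = s t) by (intros; unfold X, Y; ring).
  assert (X0 : forall th t, 0 <= th <= 1 -> 0 <= t <= 1 -> 0 <= X th t).
  { intros th t Hth Ht. specialize (sp t Ht). unfold X. nra. }
  assert (Y0 : forall th t, 0 <= th <= 1 -> 0 <= t <= 1 -> 0 <= Y th t).
  { intros th t Hth Ht. specialize (sp t Ht). unfold Y. nra. }
  (* On the zero set of [A] the image is the nonnegative direction [(1 - th, th)] scaled by
     [s t - B th t], so the sign of [B] compares both coordinates with [X] and [Y]
     simultaneously. *)
  assert (par : forall th t, A th t = 0 ->
    F (X th t) (Y th t) = (1 - th) * (s t - B th t) /\
    G (X th t) (Y th t) = th * (s t - B th t)).
  { intros th t. unfold A, B. intros E. split; lra. }
  assert (NE : forall th t, 0 <= th <= 1 -> 0 <= t <= 1 ->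
    not_expanding F G (s t) -> A th t = 0 -> 0 < B th t).
  { intros th t Hth Ht HN HA. apply Rnot_le_lt. intros HB.
    destruct (par th t HA) as [E1 E2].
    apply (HN (X th t) (Y th t)); auto; rewrite ?E1, ?E2; unfold X, Y; nra. }
  assert (NC : forall th t, 0 <= th <= 1 -> 0 <= t <= 1 ->
    not_contracting F G (s t) -> A th t = 0 -> B th t < 0).
  { intros th t Hth Ht HN HA. apply Rnot_le_lt. intros HB.
    destruct (par th t HA) as [E1 E2].
    apply (HN (X th t) (Y th t)); auto; rewrite ?E1, ?E2; unfold X, Y; nra. }
  assert (Al : forall t, 0 <= t <= 1 -> 0 <= A 0 t).
  { intros t Ht. unfold A.
    pose proof (G0 (X 0 t) (Y 0 t) ltac:(apply X0; lra) ltac:(apply Y0; lra)). lra. }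
  assert (Ar : forall t, 0 <= t <= 1 -> A 1 t <= 0).
  { intros t Ht. unfold A.
    pose proof (F0 (X 1 t) (Y 1 t) ltac:(apply X0; lra) ltac:(apply Y0; lra)). lra. }
  assert (s0 : s 0 = r) by (unfold s; ring).
  assert (s1 : s 1 = r1) by (unfold s; ring).
  assert (Z : exists th t, 0 <= th <= 1 /\ 0 <= t <= 1 /\ A th t = 0 /\ B th t = 0).
  { destruct H as [[H1 H2]|[H1 H2]].
    - apply square_zero; auto; intros x Hx; [apply NE|apply NC]; auto; try lra;
        now rewrite ?s0, ?s1.
    - destruct (square_zero A (fun x y => - B x y)) as [th [t [Hth [Ht [HA HB]]]]]; auto.
      + intros x y. now apply continuity_2d_pt_opp.
      + intros x Hx HA. enough (B x 0 < 0) by lra. apply NC; auto; [lra|now rewrite s0].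
      + intros x Hx HA. enough (0 < B x 1) by lra. apply NE; auto; [lra|now rewrite s1].
      + exists th, t. repeat split; auto; lra. }
  destruct Z as [th [t [Hth [Ht [HA HB]]]]].
  destruct (par th t HA) as [E1 E2]. rewrite HB in E1, E2.
  exists (X th t), (Y th t). rewrite XY, E1, E2. repeat split; auto.
  - apply sp; auto.
  - apply sp; auto.
  - unfold X. ring.
  - unfold Y. ring.
Qed.

(** * Solutions of [u'' = - h] *)

Lemma ex_RInt_cont (f : R -> R) a b : (forall x, continuous f x) -> ex_RInt f a b.
Proof. intros Hf. apply (ex_RInt_continuous (V := R_CompleteNormedModule)). auto. Qed.

Lemma RInt_cont_minus (f g : R -> R) a b :
  (forall x, continuous f x) -> (forall x, continuous g x) ->
  RInt (fun x => f x - g x) a b = RInt f a b - RInt g a b.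
Proof.
  intros Hf Hg.
  exact (RInt_minus (V := R_CompleteNormedModule) f g a b
           (ex_RInt_cont f a b Hf) (ex_RInt_cont g a b Hg)).
Qed.

Lemma RInt_dist (f g : R -> R) a b m : a <= b ->
  (forall x, continuous f x) -> (forall x, continuous g x) ->
  (forall x, a <= x <= b -> Rabs (f x - g x) <= m) ->
  Rabs (RInt f a b - RInt g a b) <= (b - a) * m.
Proof.
  intros Hab Hf Hg H. rewrite <- RInt_cont_minus by auto.
  apply abs_RInt_le_const; auto.
  apply ex_RInt_cont. intros x. apply (continuous_minus f g); auto.
Qed.

Lemma RInt_from_0 (h : R -> R) x y : (forall x, continuous h x) ->
  RInt h 0 y = RInt h 0 x + RInt h x y.
Proof.
  intros Hh. symmetry.
  exact (RInt_Chasles (V := R_CompleteNormedModule) h 0 x y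
           (ex_RInt_cont h 0 x Hh) (ex_RInt_cont h x y Hh)).
Qed.

Lemma is_derive_RInt_cont (h : R -> R) t : (forall x, continuous h x) ->
  is_derive (fun r => RInt h 0 r) t (h t).
Proof.
  intros Hh. apply is_derive_RInt with 0; [|apply Hh].
  apply filter_forall. intros x.
  apply (RInt_correct (V := R_CompleteNormedModule)). now apply ex_RInt_cont.
Qed.

Lemma is_derive_continuous (f : R -> R) t l : is_derive f t l -> continuous f t.
Proof. intros H. apply (ex_derive_continuous (V := R_NormedModule)). now exists l. Qed.

Lemma continuous_RInt_cont (h : R -> R) t : (forall x, continuous h x) ->
  continuous (fun r => RInt h 0 r) t.
Proof. intros Hh. eapply is_derive_continuous. now apply is_derive_RInt_cont. Qed.

(* The solution of [u'' = - h], [u 0 = p], [u' 0 = q]. *)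
Definition sol (p q : R) (h : R -> R) (t : R) : R :=
  p + q * t - RInt (fun r => RInt h 0 r) 0 t.

Lemma sol_0 p q h : sol p q h 0 = p.
Proof. unfold sol. rewrite RInt_point. change (p + q * 0 - 0 = p). ring. Qed.

Lemma sol_derive p q h t : (forall x, continuous h x) ->
  is_derive (sol p q h) t (q - RInt h 0 t).
Proof.
  intros Hh. unfold sol.
  apply (is_derive_minus (fun t => p + q * t) (fun t => RInt (fun r => RInt h 0 r) 0 t)).
  - auto_derive; auto; ring.
  - apply (is_derive_RInt_cont (fun r => RInt h 0 r)).
    intros x. now apply continuous_RInt_cont.
Qed.

Lemma sol_derive2 q h t : (forall x, continuous h x) ->
  is_derive (fun t => q - RInt h 0 t) t (- h t).
Proof.
  intros Hh. replace (- h t) with (0 - h t) by ring.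
  apply (is_derive_minus (fun _ => q) (fun t => RInt h 0 t)).
  - apply (is_derive_const q).
  - now apply is_derive_RInt_cont.
Qed.

Lemma sol_continuous p q h t : (forall x, continuous h x) -> continuous (sol p q h) t.
Proof. intros Hh. eapply is_derive_continuous. now apply sol_derive. Qed.

Lemma sol_dist p q p' q' h h' T m t :
  (forall x, continuous h x) -> (forall x, continuous h' x) ->
  0 <= t <= T -> 0 <= m -> (forall s, 0 <= s <= T -> Rabs (h s - h' s) <= m) ->
  Rabs (sol p q h t - sol p' q' h' t) <=
    Rabs (p - p') + T * Rabs (q - q') + T * (T * m).
Proof.
  intros Hh Hh' Ht Hm H. unfold sol.
  assert (HJ : Rabs (RInt (fun r => RInt h 0 r) 0 t - RInt (fun r => RInt h' 0 r) 0 t)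
     <= (t - 0) * (T * m)).
  { apply RInt_dist; [lra| | |].
    - intros x. now apply continuous_RInt_cont.
    - intros x. now apply continuous_RInt_cont.
    - intros x Hx. apply Rle_trans with ((x - 0) * m).
      + apply RInt_dist; auto; [lra|]. intros s Hs. apply H. lra.
      + nra. }
  set (J := RInt (fun r => RInt h 0 r) 0 t) in *.
  set (J' := RInt (fun r => RInt h' 0 r) 0 t) in *.
  replace (p + q * t - J - (p' + q' * t - J'))
    with ((p - p') + ((q - q') * t + - (J - J'))) by ring.
  pose proof (Rabs_triang (p - p') ((q - q') * t + - (J - J'))).
  pose proof (Rabs_triang ((q - q') * t) (- (J - J'))).
  rewrite Rabs_Ropp in *. rewrite Rabs_mult, (Rabs_pos_eq t) in * by lra.
  pose proof (Rabs_pos (q - q')).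
  assert (0 <= T * m) by nra.
  assert ((t - 0) * (T * m) <= T * (T * m)) by nra.
  assert (Rabs (q - q') * t <= T * Rabs (q - q')) by nra.
  lra.
Qed.

Lemma sol_zero p q t : sol p q (fun _ => 0) t = p + q * t.
Proof.
  unfold sol.
  rewrite (RInt_ext _ (fun _ => 0)).
  - rewrite (RInt_const (V := R_CompleteNormedModule)).
    change (p + q * t - (t - 0) * 0 = p + q * t). ring.
  - intros x _. rewrite (RInt_const (V := R_CompleteNormedModule)).
    change ((x - 0) * 0 = 0). ring.
Qed.

Lemma sol_bound p q h T m t :
  (forall x, continuous h x) -> 0 <= t <= T ->
  (forall s, 0 <= s <= T -> Rabs (h s) <= m) ->
  Rabs (sol p q h t - (p + q * t)) <= T * (T * m).
Proof.
  intros Hh Ht H. rewrite <- (sol_zero p q).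
  assert (0 <= m). { eapply Rle_trans; [apply Rabs_pos|apply (H t Ht)]. }
  pose proof (sol_dist p q p q h (fun _ => 0) T m t Hh
    (fun x => continuous_const (V := R_UniformSpace) 0 x) Ht H0) as HD.
  rewrite !Rminus_diag, Rabs_R0 in HD.
  eapply Rle_trans; [apply HD|lra].
  intros s Hs. rewrite Rminus_0_r. auto.
Qed.

(** For [q > 0] the linear term [q t] beats the error [m t^2] as soon as [t <= q / (2 (m + 1))].
    This excludes the zero solution: with [p = 0] it leaves [y = kappa q <= 0], against
    [p + y > 0]. *)
Lemma sol_nonpos_slope q h T m : 0 < T -> (forall x, continuous h x) ->
  (forall s, 0 <= s <= T -> Rabs (h s) <= m) ->
  (forall t, 0 <= t <= T -> sol 0 q h t <= 0) -> q <= 0.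
Proof.
  intros hT Ch Hh H. apply Rnot_lt_le. intros Hq.
  assert (Hm : 0 <= m) by (eapply Rle_trans; [apply Rabs_pos|apply (Hh 0); lra]).
  set (t := Rmin T (q / (2 * (m + 1)))).
  assert (Ht0 : 0 < t).
  { apply Rmin_pos; auto. apply Rdiv_lt_0_compat; lra. }
  assert (HtT : t <= T) by apply Rmin_l.
  assert (Htq : t * (2 * (m + 1)) <= q).
  { apply Rle_trans with (q / (2 * (m + 1)) * (2 * (m + 1))).
    - apply Rmult_le_compat_r; [lra|]. apply Rmin_r.
    - right. field. lra. }
  assert (HB : Rabs (sol 0 q h t - (0 + q * t)) <= t * (t * m)).
  { apply sol_bound; auto; [lra|]. intros s Hs. apply Hh. lra. }
  specialize (H t ltac:(lra)). apply Rabs_le_between in HB. nra.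
Qed.

Lemma RInt_nonneg (h : R -> R) a b : a <= b -> (forall x, continuous h x) ->
  (forall x, a <= x <= b -> 0 <= h x) -> 0 <= RInt h a b.
Proof.
  intros Hab Hh H. apply RInt_ge_0; auto.
  - now apply ex_RInt_cont.
  - intros x Hx. apply H. lra.
Qed.

Lemma sol_le p q h T t : (forall x, continuous h x) -> 0 <= t <= T ->
  (forall s, 0 <= s <= T -> 0 <= h s) -> sol p q h t <= p + q * t.
Proof.
  intros Hh Ht H. unfold sol.
  assert (0 <= RInt (fun r => RInt h 0 r) 0 t); [|lra].
  apply RInt_nonneg; [lra| |].
  - intros x. now apply continuous_RInt_cont.
  - intros x Hx. apply RInt_nonneg; auto; [lra|]. intros s Hs. apply H. lra.
Qed.

(* For [m = 0] this is concavity; the last term is the Green function of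
   the interval [x, z] integrated against the constant [m]. *)
Lemma sol_chord p q h m x y z : (forall x, continuous h x) ->
  x <= y <= z -> (forall s, x <= s <= z -> m <= h s) ->
  (z - y) * sol p q h x + (y - x) * sol p q h z +
     m / 2 * ((y - x) * (z - y) * (z - x)) <= (z - x) * sol p q h y.
Proof.
  intros Hh Hxyz H.
  (* [w'' = m - h <= 0], so the mean slopes of [w] decrease. The quadratic part contributes the
     product because [(z-y) x^2 + (y-x) z^2 - (z-x) y^2 = (y-x)(z-y)(z-x)]. *)
  set (w := fun t => sol p q h t + m / 2 * (t * t)).
  set (dw := fun t => (q - RInt h 0 t) + m * t).
  assert (Dw : forall t, is_derive w t (dw t)).
  { intros t. unfold w, dw.
    apply (is_derive_plus (sol p q h) (fun t => m / 2 * (t * t))).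
    - now apply sol_derive.
    - auto_derive; auto; field. }
  assert (Cw : forall t, continuity_pt w t).
  { intros t. apply continuity_pt_filterlim.
    exact (is_derive_continuous w t _ (Dw t)). }
  destruct (MVT_gen w x y dw) as [a [Ha Ea]]; auto.
  destruct (MVT_gen w y z dw) as [b [Hb Eb]]; auto.
  rewrite Rmin_left, Rmax_right in Ha, Hb by lra.
  assert (Hd : dw b <= dw a).
  { unfold dw. rewrite (RInt_from_0 h a b Hh).
    assert (0 <= RInt (fun s => h s - m) a b).
    { apply RInt_nonneg; [lra| |].
      - intros s. apply (continuous_minus h (fun _ => m)); auto.
        apply continuous_const.
      - intros s Hs. specialize (H s ltac:(lra)). lra. }
    rewrite (RInt_cont_minus h (fun _ => m)) in H0; auto;
      [|intros s; apply continuous_const].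
    rewrite (RInt_const (V := R_CompleteNormedModule)) in H0.
    change (scal (b - a) m) with ((b - a) * m) in H0. lra. }
  assert (Hw : (z - y) * (w x - w y) + (y - x) * (w z - w y) <= 0).
  { replace (w x - w y) with (- (dw a * (y - x))) by lra. rewrite Eb.
    assert (0 <= (z - y) * (y - x)) by nra. nra. }
  unfold w in Hw. nra.
Qed.

(** * Inequalities for concave functions *)

Definition concave_on (T : R) (u : R -> R) : Prop :=
  forall x y z, 0 <= x <= y -> y <= z <= T ->
    (z - y) * u x + (y - x) * u z <= (z - x) * u y.

Lemma sol_concave p q h T : (forall x, continuous h x) ->
  (forall s, 0 <= s <= T -> 0 <= h s) -> concave_on T (sol p q h).
Proof.
  intros Hh H x y z Hx Hz.
  pose proof (sol_chord p q h 0 x y z Hh ltac:(lra)) as HC.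
  eapply Rle_trans; [|apply HC]; [lra|]. intros s Hs. apply H. lra.
Qed.

Lemma concave_nonneg T u t : 0 < T -> concave_on T u -> 0 <= u 0 -> 0 <= u T ->
  0 <= t <= T -> 0 <= u t.
Proof. intros HT Hc H0 H1 Ht. specialize (Hc 0 t T ltac:(lra) ltac:(lra)). nra. Qed.

(** The graph at [t] lies above the chord from [s] to the endpoint beyond [t]; dropping the
    nonnegative value at that endpoint leaves at least the fraction [c / T] of [u s]. *)
Lemma concave_harnack T u c s t : concave_on T u -> (forall t, 0 <= t <= T -> 0 <= u t) ->
  0 <= c -> c <= t <= T - c -> 0 <= s <= T -> c * u s <= T * u t.
Proof.
  intros Hc Hu Hc0 Ht Hs.
  pose proof (Hu s Hs). pose proof (Hu t ltac:(lra)).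
  pose proof (Hu 0 ltac:(lra)). pose proof (Hu T ltac:(lra)).
  destruct (Rle_dec s t) as [Hst|Hst].
  - specialize (Hc s t T ltac:(lra) ltac:(lra)).
    assert (c * u s <= (T - t) * u s) by nra.
    assert (0 <= (t - s) * u T) by nra. nra.
  - specialize (Hc 0 t s ltac:(lra) ltac:(lra)).
    assert (c * u s <= t * u s) by nra.
    assert (0 <= (s - t) * u 0) by nra. nra.
Qed.

Lemma RInt_linear k l b : RInt (fun s => k + l * s) 0 b = k * b + l * (b * b) / 2.
Proof.
  apply is_RInt_unique.
  replace (k * b + l * (b * b) / 2)
    with (minus (k * b + l * (b * b) / 2) (k * 0 + l * (0 * 0) / 2))
    by (unfold minus, plus, opp; simpl; field).
  apply (is_RInt_derive (fun s => k * s + l * (s * s) / 2)).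
  - intros x _. auto_derive; auto; field.
  - intros x _. apply (ex_derive_continuous (V := R_NormedModule)). auto_derive; auto.
Qed.

(** Since [u 0 >= 0], concavity puts [u] above the line [t u(T) / T], which is integrated over
    [[0, b]]. For [b = eta] the factor [eta^2 / (2 T)] is where [alpha eta^2 < 2 T] enters. *)
Lemma concave_mean T u b : concave_on T u -> (forall x, continuous u x) ->
  0 < T -> 0 <= b <= T -> 0 <= u 0 -> b * b * u T <= 2 * T * RInt u 0 b.
Proof.
  intros Hc Cu HT Hb H0.
  assert (H : RInt (fun s => 0 + (u T / T) * s) 0 b <= RInt u 0 b).
  { apply RInt_le; [lra| |now apply ex_RInt_cont|].
    - apply ex_RInt_cont. intros x.
      apply (ex_derive_continuous (V := R_NormedModule)). auto_derive; auto.
    - intros x Hx. specialize (Hc 0 x T ltac:(lra) ltac:(lra)).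
      apply Rmult_le_reg_l with T; [lra|].
      replace (T * (0 + u T / T * x)) with (x * u T) by (field; lra). nra. }
  rewrite RInt_linear in H.
  apply Rmult_le_compat_l with (r := 2 * T) in H; [|lra].
  replace (2 * T * (0 * b + u T / T * (b * b) / 2)) with (b * b * u T) in H
    by (field; lra). lra.
Qed.

(** * The delayed equation *)

Lemma continuous_Rmax0 (x : R) : continuous (Rmax 0) x.
Proof.
  intros P [e He]. exists e. intros y Hy. apply He. revert Hy.
  unfold ball; simpl; unfold AbsRing_ball, abs, minus, plus, opp; simpl.
  unfold Rmax. intros Hy. apply Rabs_def2 in Hy. apply Rabs_def1;
  destruct (Rle_dec 0 y), (Rle_dec 0 x); lra.
Qed.

Definition forcing (a g : R -> R) (e : R) (u : R -> R) (s : R) : R :=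
  a s * g (u (Rmax 0 (s - e))).

Lemma forcing_continuous a g e u :
  (forall x, continuous a x) -> (forall x, continuous g x) ->
  (forall x, continuous u x) -> forall x, continuous (forcing a g e u) x.
Proof.
  intros Ha Hg Hu x. unfold forcing.
  apply (continuous_mult a (fun s => g (u (Rmax 0 (s - e))))); auto.
  apply (continuous_comp (fun s => u (Rmax 0 (s - e))) g); auto.
  apply (continuous_comp (fun s => Rmax 0 (s - e)) u); auto.
  apply (continuous_comp (fun s => s - e) (Rmax 0)).
  - apply (continuous_minus (fun s => s) (fun _ => e)).
    + apply continuous_id.
    + apply continuous_const.
  - apply continuous_Rmax0.
Qed.

Lemma delay_range T e s : 0 <= e -> 0 <= s <= T -> 0 <= Rmax 0 (s - e) <= T.
Proof. intros He Hs. unfold Rmax. destruct Rle_dec; lra. Qed.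

Lemma sol_ext p q h h' t : 0 <= t -> (forall s, 0 <= s <= t -> h s = h' s) ->
  sol p q h t = sol p q h' t.
Proof.
  intros Ht H. unfold sol. f_equal.
  apply (RInt_ext (V := R_CompleteNormedModule)). intros x Hx.
  rewrite Rmin_left, Rmax_right in Hx by lra.
  apply (RInt_ext (V := R_CompleteNormedModule)). intros s Hs.
  rewrite Rmin_left, Rmax_right in Hs by lra. apply H. lra.
Qed.

Fixpoint picard (a g : R -> R) (e p q : R) (k : nat) : R -> R :=
  match k with
  | O => fun _ => p
  | S k => sol p q (forcing a g e (picard a g e p q k))
  end.

(** The modulus is global because no range for the iterates is fixed in advance; truncating [f]
    provides it. *)
Definition unif_cont (g : R -> R) : Prop :=
  forall e, 0 < e -> exists d, 0 < d /\
    forall x y, Rabs (x - y) < d -> Rabs (g x - g y) <= e.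

Lemma unif_cont_continuous g x : unif_cont g -> continuous g x.
Proof.
  intros Hg. apply filterlim_locally. intros eps.
  destruct (Hg (eps / 2)) as [d [Hd H]]; [pose proof (cond_pos eps); lra|].
  exists (mkposreal d Hd). intros y Hy.
  specialize (H y x Hy). unfold ball; simpl.
  unfold AbsRing_ball, abs, minus, plus, opp; simpl.
  pose proof (cond_pos eps).
  change (Rabs (g y - g x) < eps). lra.
Qed.

(* With delay [e] the iterates are stationary on [0, k e] after [k] steps,
   so no Lipschitz condition is needed for existence and continuous dependence. *)
Lemma delay_solution (T e A : R) (a g : R -> R)
  (hT : 0 < T) (he : 0 < e)
  (ha : forall x, continuous a x) (hA : forall s, 0 <= s <= T -> 0 <= a s <= A)
  (hg : unif_cont g) :
  exists u : R -> R -> R -> R,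
    (forall p q x, continuous (u p q) x) /\
    (forall p q t, 0 <= t <= T -> u p q t = sol p q (forcing a g e (u p q)) t) /\
    (forall d, 0 < d -> exists d', 0 < d' /\ forall p q p' q',
       Rabs (p - p') < d' -> Rabs (q - q') < d' ->
       forall t, 0 <= t <= T -> Rabs (u p q t - u p' q' t) <= d).
Proof.
  assert (hg' : forall x, continuous g x) by (intros x; now apply unif_cont_continuous).
  assert (hA0 : 0 <= A) by (specialize (hA 0 ltac:(lra)); lra).
  assert (C : forall k p q x, continuous (picard a g e p q k) x).
  { induction k as [|k IH]; intros p q x; simpl; [apply continuous_const|].
    apply sol_continuous. now apply forcing_continuous. }
  assert (St : forall p q k t, 0 <= t <= INR k * e ->
    picard a g e p q k t = picard a g e p q (S k) t).
  { intros p q. induction k as [|k IH]; intros t Ht.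
    - simpl in Ht. replace t with 0 by lra. simpl. now rewrite sol_0.
    - change (sol p q (forcing a g e (picard a g e p q k)) t =
              sol p q (forcing a g e (picard a g e p q (S k))) t).
      apply sol_ext; [lra|]. intros s Hs. unfold forcing. rewrite IH; auto.
      rewrite S_INR in Ht. pose proof (pos_INR k).
      split; [apply Rmax_l|]. apply Rmax_lub; nra. }
  assert (Cd : forall k d, 0 < d -> exists d', 0 < d' /\ forall p q p' q',
       Rabs (p - p') < d' -> Rabs (q - q') < d' ->
       forall t, 0 <= t <= T ->
         Rabs (picard a g e p q k t - picard a g e p' q' k t) <= d).
  { induction k as [|k IH]; intros d Hd.
    - exists d. split; auto. intros p q p' q' Hp _ t _. simpl. lra.
    (* Half of [d] pays for the forcing, whose double integral is at most [T * T * A * m]; the other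
       half pays for the change of [p] and [q], through the factor [1 + T]. *)
    - set (m := d / (2 * (T * T * (A + 1)))).
      assert (HK : 0 < T * T * (A + 1)) by (apply Rmult_lt_0_compat; nra).
      assert (Hm : 0 < m) by (apply Rdiv_lt_0_compat; lra).
      destruct (hg m Hm) as [d1 [Hd1 G]].
      destruct (IH (d1 / 2) ltac:(lra)) as [d2 [Hd2 I]].
      exists (Rmin d2 (d / (2 * (1 + T)))). split.
      { apply Rmin_pos; auto. apply Rdiv_lt_0_compat; lra. }
      intros p q p' q' Hp Hq t Ht.
      pose proof (Rmin_l d2 (d / (2 * (1 + T)))).
      pose proof (Rmin_r d2 (d / (2 * (1 + T)))).
      simpl. eapply Rle_trans.
      { apply sol_dist with (m := A * m) (T := T); auto.
        - apply forcing_continuous; auto.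
        - apply forcing_continuous; auto.
        - nra.
        - intros s Hs. unfold forcing. rewrite <- Rmult_minus_distr_l, Rabs_mult.
          specialize (hA s Hs). rewrite (Rabs_pos_eq (a s)) by lra.
          apply Rmult_le_compat; try lra; [apply Rabs_pos|].
          apply G.
          assert (Hr := delay_range T e s ltac:(lra) Hs).
          assert (HH := I p q p' q' ltac:(lra) ltac:(lra) _ Hr). lra. }
      assert (E1 : T * T * (A + 1) * m = d / 2) by (unfold m; field; lra).
      assert (E2 : (1 + T) * (d / (2 * (1 + T))) = d / 2) by (field; lra).
      set (c := d / (2 * (1 + T))) in *.
      assert (T * Rabs (q - q') <= T * c) by (apply Rmult_le_compat_l; lra).
      assert (0 <= T * T * m) by (apply Rmult_le_pos; nra). nra. }
  (* Once [k e >= T] the iterate solves the equation on all of [[0, T]]. The same [k] serves every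
     [p], [q], so continuous dependence of the iterate is that of the solution. *)
  destruct (INR_unbounded (T / e)) as [k Hk].
  assert (Hke : T <= INR k * e).
  { apply Rlt_le. apply Rlt_div_l in Hk; lra. }
  exists (fun p q => picard a g e p q k). split; [|split].
  - intros. apply C.
  - intros p q t Ht. rewrite St by lra. reflexivity.
  - apply Cd.
Qed.

(** * The nonlocal boundary conditions *)

Record admissible (T eta alpha beta : R) : Prop := Admissible {
  adm_T : 0 < T;
  adm_eta : 0 < eta < T;
  adm_alpha : 0 < alpha;
  adm_alpha_lt : alpha * (eta * eta) < 2 * T;
  adm_beta : 0 <= beta;
  adm_beta_lt : beta * (alpha * (eta * eta) - 2 * eta + 2 * T) <
                2 * T - alpha * (eta * eta) }.

Definition kappa (T eta alpha : R) : R := T - alpha * (eta * eta) / 2.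

(* The value of [u T - alpha * RInt u 0 eta] at the affine function
   [u t = p + q t]. *)
Definition affine_defect (T eta alpha p q : R) : R :=
  (1 - alpha * eta) * p + kappa T eta alpha * q.

Definition slope (T eta alpha p y : R) : R :=
  (y - (1 - alpha * eta) * p) / kappa T eta alpha.

Lemma kappa_pos T eta alpha beta : admissible T eta alpha beta ->
  0 < kappa T eta alpha.
Proof. intros []. unfold kappa. lra. Qed.

Lemma affine_defect_slope T eta alpha beta p y : admissible T eta alpha beta ->
  affine_defect T eta alpha p (slope T eta alpha p y) = y.
Proof.
  intros H. pose proof (kappa_pos _ _ _ _ H). unfold affine_defect, slope. field. lra.
Qed.

Lemma sol_split p q h t : sol p q h t = p + q * t + sol 0 0 h t.
Proof. unfold sol. ring. Qed.

(** By linearity the boundary functional splits into its value at the affine part and at the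
    response [sol 0 0 h] with zero initial data. Hence the second boundary condition expresses [y]
    through the forcing alone. *)
Lemma sol_boundary T eta alpha p q h : (forall x, continuous h x) ->
  sol p q h T - alpha * RInt (sol p q h) 0 eta =
  affine_defect T eta alpha p q + (sol 0 0 h T - alpha * RInt (sol 0 0 h) 0 eta).
Proof.
  intros Hh.
  assert (E : RInt (sol p q h) 0 eta - RInt (sol 0 0 h) 0 eta =
              p * eta + q * (eta * eta) / 2).
  { rewrite <- RInt_cont_minus, <- RInt_linear
      by (intros; now apply sol_continuous).
    apply (RInt_ext (V := R_CompleteNormedModule)). intros x _.
    change (sol p q h x - sol 0 0 h x = p + q * x). rewrite (sol_split p q). ring. }
  unfold affine_defect, kappa. rewrite (sol_split p q h T).
  replace (RInt (sol p q h) 0 eta)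
    with (RInt (sol 0 0 h) 0 eta + (p * eta + q * (eta * eta) / 2)) by lra.
  field.
Qed.

(** The response [v = sol 0 0 h] is concave and nonpositive. The upper bound is the sign of its
    integral; the lower one is [concave_mean] with [alpha eta^2 < 2 T] and [v T <= 0], and it makes
    the quadrant invariant. *)
Lemma forced_defect_bounds T eta alpha beta h : admissible T eta alpha beta ->
  (forall x, continuous h x) -> (forall s, 0 <= s <= T -> 0 <= h s) ->
  0 <= alpha * RInt (sol 0 0 h) 0 eta - sol 0 0 h T <= - sol 0 0 h T.
Proof.
  intros [hT he ha hal _ _] Hh H.
  assert (Hc := sol_concave 0 0 h T Hh H).
  assert (Cv : forall x, continuous (sol 0 0 h) x) by (intros; now apply sol_continuous).
  assert (H0 : 0 <= sol 0 0 h 0) by (rewrite sol_0; lra).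
  pose proof (concave_mean T _ eta Hc Cv hT ltac:(lra) H0) as Hm.
  assert (Hv : forall t, 0 <= t <= T -> sol 0 0 h t <= 0).
  { intros t Ht. pose proof (sol_le 0 0 h T t Hh Ht H). lra. }
  assert (HI : 0 <= RInt (fun s => 0 - sol 0 0 h s) 0 eta).
  { apply RInt_nonneg; [lra| |].
    - intros x. apply (continuous_minus (fun _ => 0) (sol 0 0 h)); auto.
      apply continuous_const.
    - intros x Hx. specialize (Hv x ltac:(lra)). lra. }
  rewrite (RInt_cont_minus (fun _ => 0)) in HI; auto; [|intros; apply continuous_const].
  rewrite (RInt_const (V := R_CompleteNormedModule)) in HI.
  change (scal (eta - 0) 0) with ((eta - 0) * 0) in HI.
  specialize (Hv T ltac:(lra)).
  set (I := RInt (sol 0 0 h) 0 eta) in *. set (v := sol 0 0 h T) in *.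
  split; [|nra].
  apply Rmult_le_reg_l with (2 * T); [lra|].
  assert (alpha * (eta * eta * v) <= alpha * (2 * T * I)) by nra. nra.
Qed.

Lemma Rmax_dist x y : Rabs (Rmax 0 x - Rmax 0 y) <= Rabs (x - y).
Proof.
  unfold Rmax. destruct (Rle_dec 0 x), (Rle_dec 0 y); unfold Rabs;
    repeat destruct Rcase_abs; lra.
Qed.

Definition delay_eq (T e : R) (a g : R -> R) (p q : R) (u : R -> R) : Prop :=
  (forall x, continuous u x) /\
  forall t, 0 <= t <= T -> u t = sol p q (forcing a g e u) t.

(** This is [not_contracting] written for the initial data: the two inequalities on [u] say that
    neither coordinate increases under the planar map. Quantifying over all [u] makes it independent
    of the chosen family of solutions. *)
Definition no_super (T eta alpha beta e : R) (a g : R -> R) (s : R) : Prop :=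
  forall p q u, delay_eq T e a g p q u -> 0 <= p ->
    0 <= affine_defect T eta alpha p q -> p + affine_defect T eta alpha p q = s ->
    beta * Rmax 0 (u eta) <= p -> alpha * RInt u 0 eta <= u T -> False.

Definition no_sub (T eta alpha beta e : R) (a g : R -> R) (s : R) : Prop :=
  forall p q u, delay_eq T e a g p q u -> 0 <= p ->
    0 <= affine_defect T eta alpha p q -> p + affine_defect T eta alpha p q = s ->
    p <= beta * Rmax 0 (u eta) -> u T <= alpha * RInt u 0 eta -> False.

Lemma RInt_sol_ext T eta p q h u : 0 <= eta <= T ->
  (forall t, 0 <= t <= T -> u t = sol p q h t) -> RInt u 0 eta = RInt (sol p q h) 0 eta.
Proof.
  intros He H. apply (RInt_ext (V := R_CompleteNormedModule)). intros x Hx.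
  rewrite Rmin_left, Rmax_right in Hx by lra. apply H. lra.
Qed.

Lemma delayed_bvp (T eta alpha beta e A r r1 : R) (a g : R -> R)
  (adm : admissible T eta alpha beta) (he : 0 < e) (hr : 0 < r < r1)
  (ha : forall x, continuous a x) (hA : forall s, 0 <= s <= T -> 0 <= a s <= A)
  (hg : unif_cont g) (g0 : forall x, 0 <= g x)
  (H : no_sub T eta alpha beta e a g r /\ no_super T eta alpha beta e a g r1 \/
       no_super T eta alpha beta e a g r /\ no_sub T eta alpha beta e a g r1) :
  exists p q u, delay_eq T e a g p q u /\ 0 <= p /\
    0 <= affine_defect T eta alpha p q /\
    r <= p + affine_defect T eta alpha p q <= r1 /\
    p = beta * Rmax 0 (u eta) /\ u T = alpha * RInt u 0 eta.
Proof.
  pose proof (kappa_pos _ _ _ _ adm) as Hk.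
  assert (hadm := adm). destruct hadm as [hT heta hal hal' hbe hbe'].
  destruct (delay_solution T e A a g hT he ha hA hg) as [u [Cu [Eu Du]]].
  assert (g' : forall x, continuous g x) by (intros x; now apply unif_cont_continuous).
  set (sl := slope T eta alpha) in *.
  (* Away from fixed points [u] may be negative at [eta], and the truncation keeps [F] in the
     quadrant. At a fixed point [u] turns out nonnegative, so the truncation disappears. *)
  set (F := fun x y => beta * Rmax 0 (u x (sl x y) eta)).
  set (G := fun x y => y - (u x (sl x y) T - alpha * RInt (u x (sl x y)) 0 eta)).
  assert (cu : forall t, 0 <= t <= T -> forall x y, continuity_2d_pt (fun p q => u p q t) x y).
  { intros t Ht x y eps. destruct (Du (eps / 2)) as [d [Hd H']].
    { pose proof (cond_pos eps); lra. }
    exists (mkposreal d Hd). intros x' y' Hx Hy.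
    specialize (H' x' y' x y Hx Hy t Ht). pose proof (cond_pos eps). lra. }
  assert (cI : forall x y, continuity_2d_pt (fun p q => RInt (u p q) 0 eta) x y).
  { intros x y eps. pose proof (cond_pos eps).
    destruct (Du (eps / (2 * T))) as [d [Hd H']].
    { apply Rdiv_lt_0_compat; lra. }
    exists (mkposreal d Hd). intros x' y' Hx Hy.
    assert (HD : Rabs (RInt (u x' y') 0 eta - RInt (u x y) 0 eta)
              <= (eta - 0) * (eps / (2 * T))).
    { apply RInt_dist; auto; [lra|]. intros t Ht. apply H'; auto. lra. }
    assert (E : T * (eps / (2 * T)) = eps / 2) by (field; lra).
    assert (0 < eps / (2 * T)) by (apply Rdiv_lt_0_compat; lra).
    nra. }
  assert (cs : forall x y, continuity_2d_pt sl x y).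
  { intros x y. unfold sl, slope, Rdiv. apply continuity_2d_pt_mult;
      [|apply continuity_2d_pt_const].
    apply continuity_2d_pt_minus; [apply continuity_2d_pt_id2|].
    apply continuity_2d_pt_mult; [apply continuity_2d_pt_const|apply continuity_2d_pt_id1]. }
  assert (cF : forall x y, continuity_2d_pt F x y).
  { intros x y. apply continuity_2d_pt_mult; [apply continuity_2d_pt_const|].
    assert (CC : continuity_2d_pt (fun x y => u x (sl x y) eta) x y).
    { apply (continuity_2d_pt_comp2 (fun p q => u p q eta) (fun x _ => x) sl); auto.
      - apply cu. lra.
      - apply continuity_2d_pt_id1. }
    intros eps. destruct (CC eps) as [d Hd]. exists d. intros x' y' Hx Hy.
    eapply Rle_lt_trans; [apply Rmax_dist|]. now apply Hd. }
  assert (cG : forall x y, continuity_2d_pt G x y).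
  { intros x y. apply continuity_2d_pt_minus; [apply continuity_2d_pt_id2|].
    apply continuity_2d_pt_minus.
    - apply (continuity_2d_pt_comp2 (fun p q => u p q T) (fun x _ => x) sl); auto.
      + apply cu. lra.
      + apply continuity_2d_pt_id1.
    - apply continuity_2d_pt_mult; [apply continuity_2d_pt_const|].
      apply (continuity_2d_pt_comp2 (fun p q => RInt (u p q) 0 eta) (fun x _ => x) sl); auto.
      apply continuity_2d_pt_id1. }
  assert (F0 : forall x y, 0 <= x -> 0 <= y -> 0 <= F x y).
  { intros x y _ _. unfold F. apply Rmult_le_pos; auto. apply Rmax_l. }
  (* The affine part of the boundary functional equals [y] by the choice of slope and cancels; what
     remains of [G] is the quantity in [forced_defect_bounds]. *)
  assert (G0 : forall x y, 0 <= x -> 0 <= y -> 0 <= G x y).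
  { intros x y _ _. unfold G.
    rewrite (RInt_sol_ext T eta x (sl x y) _ _ ltac:(lra) (Eu x (sl x y))).
    rewrite (Eu x (sl x y) T) by lra.
    assert (Ch : forall z, continuous (forcing a g e (u x (sl x y))) z)
      by (intros; now apply forcing_continuous).
    assert (E : affine_defect T eta alpha x (sl x y) = y)
      by (eapply affine_defect_slope; eauto).
    pose proof (sol_boundary T eta alpha x (sl x y) _ Ch).
    pose proof (forced_defect_bounds T eta alpha beta _ adm Ch) as HF.
    destruct HF as [HF _]; [|lra].
    intros s Hs. apply Rmult_le_pos; auto. apply hA; auto. }
  assert (DE : forall x y, delay_eq T e a g x (sl x y) (u x (sl x y))).
  { intros x y. split; [apply Cu|apply Eu]. }
  assert (Hne : forall s, no_sub T eta alpha beta e a g s -> not_expanding F G s).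
  { intros s Hs x y Hx Hy Hxy HF HG. unfold G in HG.
    apply (Hs x (sl x y) (u x (sl x y))); auto;
      try (unfold sl; erewrite affine_defect_slope by eauto; assumption). lra. }
  assert (Hnc : forall s, no_super T eta alpha beta e a g s -> not_contracting F G s).
  { intros s Hs x y Hx Hy Hxy HF HG. unfold G in HG.
    apply (Hs x (sl x y) (u x (sl x y))); auto;
      try (unfold sl; erewrite affine_defect_slope by eauto; assumption). lra. }
  destruct (annulus_fixed_point F G r r1 hr cF cG F0 G0) as [x [y [Hx [Hy [Hs [HF HG]]]]]].
  { destruct H as [[H1 H2]|[H1 H2]]; [left|right]; auto. }
  exists x, (sl x y), (u x (sl x y)). unfold G in HG.
  split; [apply DE|]. unfold sl at 1 2 3. rewrite !(affine_defect_slope _ _ _ _ _ _ adm).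
  repeat split; auto; try lra.
Qed.

(** * A priori estimates for sub- and supersolutions *)

(** The second inequality bounds [y] by minus the zero-data response at [T], hence by [T^2 m]. As
    [u eta <= p + q eta], the first one, multiplied by [kappa], becomes [D p <= beta eta y]. *)
Lemma sub_bound (T eta alpha beta : R) (adm : admissible T eta alpha beta) :
  exists K, 0 < K /\ forall p q h m, (forall x, continuous h x) ->
    (forall s, 0 <= s <= T -> 0 <= h s <= m) -> 0 <= p ->
    0 <= affine_defect T eta alpha p q ->
    p <= beta * Rmax 0 (sol p q h eta) ->
    sol p q h T <= alpha * RInt (sol p q h) 0 eta ->
    p + affine_defect T eta alpha p q <= K * m.
Proof.
  pose proof (kappa_pos _ _ _ _ adm) as Hk.
  assert (hadm := adm). destruct hadm as [hT heta hal hal' hbe hbe'].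
  (* [D] is the determinant of the two boundary conditions on affine functions; [2 D > 0] is exactly
     the hypothesis on [beta]. *)
  set (D := kappa T eta alpha * (1 - beta) + beta * eta * (1 - alpha * eta)).
  assert (HD : 0 < D) by (unfold D, kappa; lra).
  assert (Hb : 0 <= beta * eta / D).
  { apply Rle_mult_inv_pos; auto. nra. }
  exists (T * T * (1 + beta * eta / D)). split.
  { apply Rmult_lt_0_compat; nra. }
  intros p q h m Ch Hh Hp Hy HF HG.
  set (y := affine_defect T eta alpha p q) in *.
  assert (Hh0 : forall s, 0 <= s <= T -> 0 <= h s) by (intros; now apply Hh).
  assert (Hy2 : y <= T * (T * m)).
  { pose proof (sol_boundary T eta alpha p q h Ch) as HB.
    pose proof (forced_defect_bounds T eta alpha beta h adm Ch Hh0) as HF2.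
    assert (HV : Rabs (sol 0 0 h T - (0 + 0 * T)) <= T * (T * m)).
    { apply sol_bound; auto; [lra|]. intros s Hs. specialize (Hh s Hs).
      rewrite Rabs_pos_eq; lra. }
    apply Rabs_le_between in HV. fold y in HB. lra. }
  assert (HDp : D * p <= beta * eta * y).
  { assert (0 <= beta * eta) by nra.
    unfold Rmax in HF. destruct Rle_dec.
    - pose proof (sol_le p q h T eta Ch ltac:(lra) Hh0) as HL.
      assert (HpL : p <= beta * (p + q * eta)).
      { eapply Rle_trans; [apply HF|]. apply Rmult_le_compat_l; auto. }
      apply Rmult_le_compat_l with (r := kappa T eta alpha) in HpL; [|lra].
      unfold y, affine_defect, D. nra.
    - assert (p = 0) by lra. subst p. nra. }
  assert (p <= beta * eta / D * y).
  { apply Rmult_le_reg_l with D; auto.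
    replace (D * (beta * eta / D * y)) with (beta * eta * y) by (field; lra). auto. }
  nra.
Qed.

(** By concavity only the value at [T] matters. If it were negative, [concave_mean] and the integral
    inequality would give [alpha eta^2 >= 2 T]. *)
Lemma super_nonneg T eta alpha beta p q h t : admissible T eta alpha beta ->
  (forall x, continuous h x) -> (forall s, 0 <= s <= T -> 0 <= h s) -> 0 <= p ->
  alpha * RInt (sol p q h) 0 eta <= sol p q h T -> 0 <= t <= T -> 0 <= sol p q h t.
Proof.
  intros [hT he ha hal _ _] Ch Hh Hp HG Ht.
  assert (Hc := sol_concave p q h T Ch Hh).
  assert (H0 : 0 <= sol p q h 0) by (now rewrite sol_0).
  apply (concave_nonneg T); auto.
  pose proof (concave_mean T _ eta Hc (fun x => sol_continuous p q h x Ch) hT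
    ltac:(lra) H0) as Hm.
  apply Rnot_lt_le. intros Hlt.
  set (I := RInt (sol p q h) 0 eta) in *. set (v := sol p q h T) in *.
  assert (alpha * (eta * eta * v) <= alpha * (2 * T * I)) by nra. nra.
Qed.

(** Since [kappa q = y - (1 - alpha eta) p], the size [p + y] controls the initial data, and through
    [sol_le] also the solution from above. *)
Lemma param_bound (T eta alpha beta : R) (adm : admissible T eta alpha beta) :
  exists C, 0 < C /\ forall p q, 0 <= p -> 0 <= affine_defect T eta alpha p q ->
    Rabs q <= C * (p + affine_defect T eta alpha p q) /\
    forall t, 0 <= t <= T -> p + q * t <= C * (p + affine_defect T eta alpha p q).
Proof.
  pose proof (kappa_pos _ _ _ _ adm) as Hk. destruct adm as [hT _ _ _ _ _].
  set (k := kappa T eta alpha) in *.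
  set (c := (1 + Rabs (1 - alpha * eta)) / k).
  assert (Hc : 0 < c).
  { apply Rdiv_lt_0_compat; auto. pose proof (Rabs_pos (1 - alpha * eta)). lra. }
  exists (1 + c + T * c). split; [nra|]. intros p q Hp Hy.
  set (y := affine_defect T eta alpha p q) in *.
  assert (Hq : Rabs q <= c * (p + y)).
  { apply Rmult_le_reg_l with k; auto.
    replace (k * (c * (p + y))) with ((1 + Rabs (1 - alpha * eta)) * (p + y))
      by (unfold c; field; lra).
    rewrite <- (Rabs_pos_eq k) at 1 by lra. rewrite <- Rabs_mult.
    replace (k * q) with (y - (1 - alpha * eta) * p)
      by (unfold y, affine_defect; fold k; ring).
    eapply Rle_trans; [apply Rabs_triang|].
    rewrite Rabs_Ropp, Rabs_mult, (Rabs_pos_eq y), (Rabs_pos_eq p) by lra.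
    pose proof (Rabs_pos (1 - alpha * eta)). nra. }
  assert (0 <= T * c) by nra.
  split; [nra|]. intros t Ht.
  pose proof (Rle_abs q). pose proof (Rabs_pos q).
  assert (q * t <= T * (c * (p + y))).
  { apply Rle_trans with (Rabs q * t); nra. }
  nra.
Qed.

Lemma delay_eq_forcing T e a f p q u A : 0 < e ->
  (forall x, continuous a x) -> (forall x, continuous f x) ->
  (forall s, 0 <= s <= T -> 0 <= a s <= A) -> (forall x, 0 <= f x) ->
  delay_eq T e a f p q u ->
  (forall x, continuous (forcing a f e u) x) /\
  (forall s, 0 <= s <= T -> 0 <= forcing a f e u s) /\
  (forall t, 0 <= t <= T -> u t <= p + q * t).
Proof.
  intros he Ca Cf hA f0 [Cu Eu].
  assert (Ch : forall x, continuous (forcing a f e u) x)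
    by (intros; now apply forcing_continuous).
  assert (H0 : forall s, 0 <= s <= T -> 0 <= forcing a f e u s).
  { intros s Hs. apply Rmult_le_pos; auto. now apply hA. }
  repeat split; auto.
  intros t Ht. rewrite Eu by auto. now apply (sol_le p q _ T).
Qed.

(** Here [u <= C s], so the forcing is at most [A eps s] and [sub_bound] yields
    [s <= K A eps s <= s / 2]. Bounding [f] by [eps s] on [x <= C s], instead of bounding the ratio
    pointwise, lets one lemma serve small and large [s]. *)
Lemma no_sub_of_small (T eta alpha beta A : R) (a : R -> R)
  (adm : admissible T eta alpha beta) (Ca : forall x, continuous a x)
  (hA : forall s, 0 <= s <= T -> 0 <= a s <= A) :
  exists C eps, 0 < C /\ 0 < eps /\
    forall f e s, 0 < e -> 0 < s -> (forall x, continuous f x) -> (forall x, 0 <= f x) ->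
      (forall x, x <= C * s -> f x <= eps * s) -> no_sub T eta alpha beta e a f s.
Proof.
  destruct (sub_bound T eta alpha beta adm) as [K [HK HB]].
  destruct (param_bound T eta alpha beta adm) as [C [HC HP]].
  destruct adm as [hT heta _ _ _ _].
  assert (A0 : 0 <= A) by (specialize (hA 0 ltac:(lra)); lra).
  exists C, (/ (2 * K * (A + 1))). split; auto. split.
  { apply Rinv_0_lt_compat. nra. }
  set (eps := / (2 * K * (A + 1))).
  assert (Heps : 0 < eps) by (apply Rinv_0_lt_compat; nra).
  intros f e s he hs Cf f0 Hf p q u HD Hp Hy Hpy HF HG.
  destruct (delay_eq_forcing T e a f p q u A he Ca Cf hA f0 HD) as [Ch [H0 Hle]].
  destruct HD as [Cu Eu].
  rewrite (RInt_sol_ext T eta p q _ u ltac:(lra) Eu) in HG.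
  rewrite Eu in HF, HG by lra.
  assert (HH : p + affine_defect T eta alpha p q <= K * (A * (eps * s))).
  { apply (HB p q (forcing a f e u)); auto.
    intros t Ht. split; auto. unfold forcing. specialize (hA t Ht).
    apply Rmult_le_compat; auto; try lra. apply Hf.
    assert (Hr := delay_range T e t ltac:(lra) Ht).
    eapply Rle_trans; [apply Hle; auto|].
    destruct (HP p q Hp Hy) as [_ HP2]. rewrite Hpy in HP2. auto. }
  rewrite Hpy in HH.
  assert (E : K * (A + 1) * eps = / 2) by (unfold eps; field; nra).
  assert (K * A * eps <= / 2) by nra.
  nra.
Qed.

(** On [[c/2, d]] the Harnack inequality gives [u >= (g / T) u z] at the midpoint [z] of [[c, d]].
    The delay [e <= c/2] keeps the arguments in that interval, so the forcing on [[c, d]] is at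
    least a multiple of [u z], and the Green function returns more than [u z] unless it vanishes. *)
Lemma super_mid (T eta alpha beta A a0 c d M e p q : R) (a f u : R -> R)
  (adm : admissible T eta alpha beta) (Ca : forall x, continuous a x)
  (hA : forall s, 0 <= s <= T -> 0 <= a s <= A) (hcd : 0 < c < d) (hd : d < T)
  (ha0 : 0 < a0) (ha : forall s, c <= s <= d -> a0 <= a s)
  (hM : 8 * T < Rmin (c / 2) (T - d) * M * a0 * ((d - c) * (d - c)))
  (he : 0 < e <= c / 2) (Cf : forall x, continuous f x) (f0 : forall x, 0 <= f x)
  (HD : delay_eq T e a f p q u) (hu : forall t, 0 <= t <= T -> 0 <= u t)
  (Hf : forall t, c / 2 <= t <= d -> M * u t <= f (u t)) :
  u ((c + d) / 2) <= 0.
Proof.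
  destruct (delay_eq_forcing T e a f p q u A ltac:(lra) Ca Cf hA f0 HD) as [Ch [H0 _]].
  destruct HD as [Cu Eu].
  destruct adm as [hT heta _ _ _ _].
  set (h := forcing a f e u) in *.
  set (z := (c + d) / 2). set (g := Rmin (c / 2) (T - d)) in *.
  assert (Hg : 0 < g) by (apply Rmin_pos; lra).
  assert (g1 : g <= c / 2) by apply Rmin_l.
  assert (g2 : g <= T - d) by apply Rmin_r.
  assert (Hconc : concave_on T u).
  { intros x y w Hx Hw. rewrite !Eu by lra.
    apply (sol_concave p q h T); auto. }
  assert (HM : 0 < M).
  { apply Rnot_le_lt. intros HM.
    assert (0 <= g * a0 * ((d - c) * (d - c))).
    { apply Rmult_le_pos; nra. }
    nra. }
  assert (Hz : 0 <= u z) by (apply hu; unfold z; lra).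
  set (m := a0 * (M * (g / T * u z))).
  assert (Hm : forall s, c <= s <= d -> m <= h s).
  { intros s Hs. unfold h, forcing, m.
    assert (Hr : c / 2 <= Rmax 0 (s - e) <= d).
    { unfold Rmax. destruct Rle_dec; lra. }
    set (t := Rmax 0 (s - e)) in *.
    pose proof (concave_harnack T u g z t Hconc hu ltac:(lra) ltac:(lra)
      ltac:(unfold z; lra)) as HH.
    assert (Hgu : g / T * u z <= u t).
    { apply Rmult_le_reg_l with T; [lra|].
      replace (T * (g / T * u z)) with (g * u z) by (field; lra). lra. }
    assert (0 <= g / T * u z).
    { apply Rmult_le_pos; auto. apply Rle_mult_inv_pos; lra. }
    apply Rmult_le_compat; try lra.
    - nra.
    - now apply ha.
    - eapply Rle_trans; [|now apply Hf]. nra. }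
  pose proof (sol_chord p q h m c z d Ch ltac:(unfold z; lra) Hm) as HC.
  rewrite <- !Eu in HC by (unfold z; lra).
  pose proof (hu c ltac:(lra)). pose proof (hu d ltac:(lra)).
  (* The Green function term at the midpoint is [m (d - c)^3 / 8]; the values at [c] and [d] are
     nonnegative and are dropped. *)
  assert (HC2 : m * ((d - c) * (d - c)) <= 8 * u z).
  { apply Rmult_le_reg_l with (d - c); [lra|].
    replace (d - z) with ((d - c) / 2) in HC by (unfold z; field).
    replace (z - c) with ((d - c) / 2) in HC by (unfold z; field).
    nra. }
  unfold m in HC2.
  apply Rmult_le_compat_l with (r := T) in HC2; [|lra].
  replace (T * (a0 * (M * (g / T * u z)) * ((d - c) * (d - c))))
    with (u z * (g * M * a0 * ((d - c) * (d - c)))) in HC2 by (field; lra).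
  apply Rnot_lt_le. intros Hlt. nra.
Qed.

(** If [f x >= M x] on the whole range of [u], [super_mid] and Harnack force [u = 0], which has no
    positive size. If it holds only for large [x], then [u] cannot be large at the midpoint, hence
    nowhere, and its initial data are bounded. *)
Lemma no_super_of_large (T eta alpha beta A a0 c d : R) (a : R -> R)
  (adm : admissible T eta alpha beta) (Ca : forall x, continuous a x)
  (hA : forall s, 0 <= s <= T -> 0 <= a s <= A) (hcd : 0 < c < d) (hd : d < T)
  (ha0 : 0 < a0) (ha : forall s, c <= s <= d -> a0 <= a s) :
  exists M, 0 < M /\ forall f, (forall x, continuous f x) -> (forall x, 0 <= f x) ->
    (exists C, 0 < C /\ forall e s, 0 < e <= c / 2 -> 0 < s ->
      (forall x, 0 <= x <= C * s -> M * x <= f x) ->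
      no_super T eta alpha beta e a f s) /\
    (forall x1, (forall x, x1 <= x -> M * x <= f x) ->
      exists S, forall e s, 0 < e <= c / 2 -> S < s ->
      no_super T eta alpha beta e a f s).
Proof.
  pose proof (kappa_pos _ _ _ _ adm) as Hk.
  destruct (param_bound T eta alpha beta adm) as [C [HC HP]].
  assert (hadm := adm). destruct hadm as [hT heta hal hal' hbe hbe'].
  assert (A0 : 0 <= A) by (specialize (hA 0 ltac:(lra)); lra).
  set (g := Rmin (c / 2) (T - d)).
  assert (Hg : 0 < g) by (apply Rmin_pos; lra).
  assert (g1 : g <= c / 2) by apply Rmin_l.
  assert (g2 : g <= T - d) by apply Rmin_r.
  set (W := g * a0 * ((d - c) * (d - c))).
  assert (HW : 0 < W) by (unfold W; repeat apply Rmult_lt_0_compat; lra).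
  (* Chosen so that [g * M * a0 * (d - c)^2 = 9 T], just above the threshold [8 T] of
     [super_mid]. *)
  exists (9 * T / W).
  assert (HM0 : 0 < 9 * T / W) by (apply Rdiv_lt_0_compat; lra).
  split; [auto|].
  intros f Cf f0.
  set (M := 9 * T / W) in *.
  assert (HM : 8 * T < g * M * a0 * ((d - c) * (d - c))).
  { replace (g * M * a0 * ((d - c) * (d - c))) with (9 * T); [lra|].
    unfold M, W. field. lra. }
  assert (Hbasic : forall e p q u, 0 < e -> delay_eq T e a f p q u -> 0 <= p ->
     alpha * RInt u 0 eta <= u T ->
     u 0 = p /\ concave_on T u /\ forall t, 0 <= t <= T -> 0 <= u t).
  { intros e p q u he HD Hp HG.
    destruct (delay_eq_forcing T e a f p q u A he Ca Cf hA f0 HD) as [Ch [H0 _]].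
    destruct HD as [Cu Eu].
    rewrite (RInt_sol_ext T eta p q _ u ltac:(lra) Eu), (Eu T) in HG by lra.
    split; [|split].
    - rewrite Eu by lra. apply sol_0.
    - intros x y w Hx Hw. rewrite !Eu by lra. apply (sol_concave p q _ T); auto.
    - intros t Ht. rewrite Eu by auto.
      apply (super_nonneg T eta alpha beta); auto. }
  split.
  - exists C. split; auto. intros e s he hs Hf p q u HD Hp Hy Hpy HF HG.
    destruct (Hbasic e p q u ltac:(lra) HD Hp HG) as [Hu0 [Hconc Hu]].
    destruct (delay_eq_forcing T e a f p q u A ltac:(lra) Ca Cf hA f0 HD) as [Ch [H0 Hle]].
    assert (Hz : u ((c + d) / 2) <= 0).
    { eapply (super_mid T eta alpha beta A a0 c d M e p q a f u); auto.
      intros t Ht. apply Hf. split; [apply Hu; lra|].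
      eapply Rle_trans; [apply Hle; lra|]. rewrite <- Hpy. apply HP; auto. lra. }
    assert (Hzero : forall t, 0 <= t <= T -> u t = 0).
    { intros t Ht. apply Rle_antisym; [|now apply Hu].
      pose proof (concave_harnack T u g t ((c + d) / 2) Hconc Hu ltac:(lra)
        ltac:(lra) Ht). nra. }
    assert (Hp0 : p = 0) by (rewrite <- Hu0; apply Hzero; lra).
    destruct HD as [Cu Eu]. subst p. rewrite Hp0 in *.
    unfold affine_defect in Hpy.
    assert (Hq : q <= 0).
    { apply (sol_nonpos_slope q (forcing a f e u) T (A * f 0)); auto.
      - intros t Ht. rewrite Rabs_pos_eq by auto. unfold forcing.
        rewrite Hzero by (apply delay_range; lra).
        apply Rmult_le_compat_r; auto. now apply hA.
      - intros t Ht. rewrite <- Eu, Hzero by auto. lra. }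
    nra.
  - intros x1 Hx1.
    set (x2 := Rmax 0 x1).
    assert (Hx2 : 0 <= x2) by apply Rmax_l.
    assert (Hx12 : x1 <= x2) by apply Rmax_r.
    (* Each factor [T / g] is one use of Harnack: from the midpoint to [[c/2, d]], and from an
       arbitrary point to the midpoint. *)
    set (U1 := T / g * (T / g * x2)).
    assert (HTg : 0 < T / g) by (apply Rdiv_lt_0_compat; lra).
    assert (HU1 : 0 <= U1).
    { apply Rmult_le_pos; [lra|]. apply Rmult_le_pos; lra. }
    destruct (continuity_ab_maj f 0 U1 HU1) as [xm [Hmax _]].
    { intros x _. apply continuity_pt_filterlim. apply Cf. }
    set (m := A * f xm). assert (Hm : 0 <= m) by (apply Rmult_le_pos; auto).
    (* The summands bound [p], [(1 - alpha eta) p] and [kappa q]; the bound on [q] comes from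
       [u T <= U1] and the bounded forcing. *)
    exists (U1 + Rabs (1 - alpha * eta) * U1 +
            kappa T eta alpha * ((U1 + T * (T * m)) / T)).
    intros e s he hs p q u HD Hp Hy Hpy HF HG.
    destruct (Hbasic e p q u ltac:(lra) HD Hp HG) as [Hu0 [Hconc Hu]].
    destruct (delay_eq_forcing T e a f p q u A ltac:(lra) Ca Cf hA f0 HD) as [Ch [H0 Hle]].
    set (z := (c + d) / 2).
    assert (Hz : u z <= T / g * x2).
    { apply Rnot_lt_le. intros Hlt.
      assert (Hz : u z <= 0).
      { eapply (super_mid T eta alpha beta A a0 c d M e p q a f u); auto.
        intros t Ht. apply Hx1. apply Rle_trans with x2; auto.
        pose proof (concave_harnack T u g z t Hconc Hu ltac:(lra)
          ltac:(lra) ltac:(unfold z; lra)) as HH.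
        apply Rmult_le_reg_l with T; [lra|].
        apply Rle_trans with (g * u z); auto.
        apply Rle_trans with (g * (T / g * x2)); [|nra].
        right. field. lra. }
      assert (0 <= T / g * x2) by (apply Rmult_le_pos; lra). lra. }
    assert (HU : forall t, 0 <= t <= T -> u t <= U1).
    { intros t Ht.
      pose proof (concave_harnack T u g t z Hconc Hu ltac:(lra)
        ltac:(unfold z; lra) Ht) as HH.
      apply Rmult_le_reg_l with g; [lra|].
      apply Rle_trans with (T * u z); auto.
      apply Rle_trans with (T * (T / g * x2)); [nra|].
      unfold U1. right. field. lra. }
    destruct HD as [Cu Eu].
    assert (HB : Rabs (sol p q (forcing a f e u) T - (p + q * T)) <= T * (T * m)).
    { apply sol_bound; auto; [lra|]. intros t Ht.
      rewrite Rabs_pos_eq by (apply H0; lra). unfold forcing, m.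
      assert (Hr := delay_range T e t ltac:(lra) Ht).
      apply Rmult_le_compat; auto; try apply hA; auto. }
    rewrite <- Eu in HB by lra. apply Rabs_le_between in HB.
    pose proof (HU T ltac:(lra)). pose proof (HU 0 ltac:(lra)). rewrite Hu0 in *.
    assert (Hq : q <= (U1 + T * (T * m)) / T).
    { apply Rle_div_r; lra. }
    assert (Hpa : (1 - alpha * eta) * p <= Rabs (1 - alpha * eta) * U1).
    { apply Rle_trans with (Rabs (1 - alpha * eta) * p).
      - apply Rmult_le_compat_r; auto. apply Rle_abs.
      - apply Rmult_le_compat_l; auto. apply Rabs_pos. }
    unfold affine_defect in Hpy.
    assert (kappa T eta alpha * q <= kappa T eta alpha * ((U1 + T * (T * m)) / T)).
    { apply Rmult_le_compat_l; lra. }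
    lra.
Qed.

(** * Removing the delay *)

(** The pointwise ultrafilter limit inherits the Lipschitz constant, and closeness at finitely many
    grid points then spreads to [[0, T]]. The sequences [x], [y] carry the initial data along with
    the same index. *)
Lemma ascoli_cluster (T L B : R) (v : nat -> R -> R) (x y : nat -> R)
  (hL : 0 <= L) (hv : forall n t, Rabs (v n t) <= B)
  (hlip : forall n s t, Rabs (v n s - v n t) <= L * Rabs (s - t))
  (hx : forall n, Rabs (x n) <= B) (hy : forall n, Rabs (y n) <= B) :
  exists w x0 y0, (forall s t, Rabs (w s - w t) <= L * Rabs (s - t)) /\
    forall e N, 0 < e -> exists n, (N <= n)%nat /\
      Rabs (x n - x0) < e /\ Rabs (y n - y0) < e /\
      forall t, 0 <= t <= T -> Rabs (v n t - w t) <= e.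
Proof.
  destruct ultrafilter_on_nat as [U hU].
  assert (Hlim : forall z : nat -> R, (forall n, Rabs (z n) <= B) ->
    exists l, forall e, 0 < e -> U (fun n => Rabs (z n - l) < e)).
  { intros z Hz. destruct (ultra_bounded_lim U hU z (- B) B) as [l [_ Hl]].
    - intros n. now apply Rabs_le_between.
    - now exists l. }
  destruct (Hlim x hx) as [x0 Lx]. destruct (Hlim y hy) as [y0 Ly].
  set (w := fun t => proj1_sig (constructive_indefinite_description _
              (Hlim (fun n => v n t) (fun n => hv n t)))).
  assert (Lw : forall t e, 0 < e -> U (fun n => Rabs (v n t - w t) < e)).
  { intros t. unfold w. apply proj2_sig. }
  assert (Hw : forall s t, Rabs (w s - w t) <= L * Rabs (s - t)).
  { intros s t. apply le_epsilon. intros e He.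
    destruct (ultra_ex _ hU _ (ultra_and _ hU _ _ (Lw s (e / 2) ltac:(lra))
                (Lw t (e / 2) ltac:(lra)))) as [n [H1 H2]].
    specialize (hlip n s t).
    replace (w s - w t) with (- (v n s - w s) + ((v n s - v n t) + (v n t - w t))) by ring.
    pose proof (Rabs_triang (- (v n s - w s)) ((v n s - v n t) + (v n t - w t))).
    pose proof (Rabs_triang (v n s - v n t) (v n t - w t)).
    rewrite Rabs_Ropp in *. lra. }
  exists w, x0, y0. split; auto. intros e N He.
  (* The mesh makes [L k <= e / 3]: one third of [e] each for [v n], for [w], and for their distance
     at the grid point. *)
  set (k := e / (3 * (L + 1))).
  assert (Hk : 0 < k) by (apply Rdiv_lt_0_compat; lra).
  assert (HLk : L * k <= e / 3).
  { apply Rle_trans with ((L + 1) * k); [nra|]. unfold k. right. field. lra. }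
  assert (Hunif : forall i, U (fun n => forall t, 0 <= t <= INR i * k ->
                     Rabs (v n t - w t) <= e)).
  { induction i as [|i IH].
    - generalize (Lw 0 e He). apply (ultra_imp _ hU). intros n Hn t Ht.
      simpl in Ht. replace t with 0 by lra. lra.
    - generalize (ultra_and _ hU _ _ IH (Lw (INR i * k) (e / 3) ltac:(lra))).
      apply (ultra_imp _ hU). intros n [H1 H2] t Ht.
      destruct (Rle_dec t (INR i * k)) as [Hl|Hl]; [apply H1; lra|].
      rewrite S_INR in Ht.
      assert (Habs : Rabs (t - INR i * k) <= k) by (rewrite Rabs_pos_eq; lra).
      pose proof (hlip n t (INR i * k)). pose proof (Hw t (INR i * k)).
      assert (L * Rabs (t - INR i * k) <= L * k) by (apply Rmult_le_compat_l; auto).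
      set (s := INR i * k) in *.
      replace (v n t - w t) with ((v n t - v n s) + ((v n s - w s) + - (w t - w s))) by ring.
      pose proof (Rabs_triang (v n t - v n s) ((v n s - w s) + - (w t - w s))).
      pose proof (Rabs_triang (v n s - w s) (- (w t - w s))).
      rewrite Rabs_Ropp in *. lra. }
  destruct (INR_unbounded (T / k)) as [i Hi].
  assert (HiT : T <= INR i * k) by (apply Rlt_le; apply Rlt_div_l in Hi; lra).
  assert (HN : U (fun n => (N <= n)%nat)) by (apply (ultra_ev _ hU); now exists N).
  destruct (ultra_ex _ hU _ (ultra_and _ hU _ _ HN (ultra_and _ hU _ _ (Hunif i)
     (ultra_and _ hU _ _ (Lx e He) (Ly e He))))) as [n [H1 [H2 [H3 H4]]]].
  exists n. repeat split; auto. intros t Ht. apply H2. lra.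
Qed.

Lemma sol_lipschitz p q h T m s t : (forall x, continuous h x) ->
  (forall s, 0 <= s <= T -> Rabs (h s) <= m) -> 0 <= s <= T -> 0 <= t <= T ->
  Rabs (sol p q h s - sol p q h t) <= (Rabs q + T * m) * Rabs (s - t).
Proof.
  intros Ch Hh Hs Ht.
  destruct (MVT_gen (sol p q h) t s (fun t => q - RInt h 0 t)) as [c [Hc E]].
  - intros x _. now apply sol_derive.
  - intros x _. apply continuity_pt_filterlim. now apply sol_continuous.
  - rewrite E, Rabs_mult. apply Rmult_le_compat_r; [apply Rabs_pos|].
    assert (Hc' : 0 <= c <= T).
    { revert Hc. unfold Rmin, Rmax. repeat destruct Rle_dec; lra. }
    assert (HR : Rabs (RInt h 0 c) <= (c - 0) * m).
    { apply abs_RInt_le_const; [lra|now apply ex_RInt_cont|].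
      intros x Hx. apply Hh. lra. }
    pose proof (Rabs_triang q (- RInt h 0 c)) as HT. rewrite Rabs_Ropp in HT.
    assert (0 <= m) by (eapply Rle_trans; [apply Rabs_pos|apply (Hh s Hs)]).
    change (q - RInt h 0 c) with (q + - RInt h 0 c).
    assert ((c - 0) * m <= T * m) by (apply Rmult_le_compat_r; lra). lra.
Qed.

Definition clamp (T x : R) : R := Rmin T (Rmax 0 x).

Lemma clamp_range T x : 0 <= T -> 0 <= clamp T x <= T.
Proof. intros HT. unfold clamp, Rmin, Rmax. repeat destruct Rle_dec; lra. Qed.

Lemma clamp_id T x : 0 <= x <= T -> clamp T x = x.
Proof. intros Hx. unfold clamp, Rmin, Rmax. repeat destruct Rle_dec; lra. Qed.

Lemma clamp_dist T x y : 0 <= T -> Rabs (clamp T x - clamp T y) <= Rabs (x - y).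
Proof.
  intros HT. unfold clamp, Rmin, Rmax.
  repeat destruct Rle_dec; unfold Rabs; repeat destruct Rcase_abs; lra.
Qed.

Lemma lipschitz_continuous (w : R -> R) L x : 0 <= L ->
  (forall s t, Rabs (w s - w t) <= L * Rabs (s - t)) -> continuous w x.
Proof.
  intros HL Hw. apply unif_cont_continuous. intros e He.
  exists (e / (L + 1)). split; [apply Rdiv_lt_0_compat; lra|].
  intros s t Hst. eapply Rle_trans; [apply Hw|].
  assert (E : (L + 1) * (e / (L + 1)) = e) by (field; lra).
  pose proof (Rabs_pos (s - t)). nra.
Qed.

Lemma eq_of_small x K : (forall d, 0 < d -> Rabs x <= K * d) -> x = 0.
Proof.
  intros H. apply Rabs_eq_0. apply Rle_antisym; [|apply Rabs_pos].
  apply le_epsilon. intros e He.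
  assert (HK : 0 < Rabs K + 1) by (pose proof (Rabs_pos K); lra).
  specialize (H (e / (Rabs K + 1)) ltac:(apply Rdiv_lt_0_compat; lra)).
  assert (E : (Rabs K + 1) * (e / (Rabs K + 1)) = e) by (field; lra).
  pose proof (Rle_abs K).
  assert (0 < e / (Rabs K + 1)) by (apply Rdiv_lt_0_compat; lra). nra.
Qed.

Lemma le_of_small x K : (forall d, 0 < d -> x <= K * d) -> x <= 0.
Proof.
  intros H. apply Rnot_lt_le. intros Hx.
  assert (E : x = 0); [|lra].
  apply eq_of_small with K. intros d Hd. rewrite Rabs_pos_eq; auto. lra.
Qed.

Lemma delay_limit (T eta alpha beta e0 A G r r1 : R) (a g : R -> R)
  (adm : admissible T eta alpha beta) (he0 : 0 < e0)
  (Ca : forall x, continuous a x) (hA : forall s, 0 <= s <= T -> 0 <= a s <= A)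
  (hg : unif_cont g) (g0 : forall x, 0 <= g x <= G)
  (H : forall e, 0 < e <= e0 -> exists p q u, delay_eq T e a g p q u /\ 0 <= p /\
    0 <= affine_defect T eta alpha p q /\
    r <= p + affine_defect T eta alpha p q <= r1 /\
    p = beta * Rmax 0 (u eta) /\ u T = alpha * RInt u 0 eta) :
  exists p q u, (forall x, continuous u x) /\
    (forall t, 0 <= t <= T -> u t = sol p q (fun s => a s * g (u s)) t) /\ 0 <= p /\
    0 <= affine_defect T eta alpha p q /\
    r <= p + affine_defect T eta alpha p q <= r1 /\
    p = beta * Rmax 0 (u eta) /\ u T = alpha * RInt u 0 eta.
Proof.
  destruct (param_bound T eta alpha beta adm) as [C [HC HP]].
  pose proof (kappa_pos _ _ _ _ adm) as Hk.
  destruct adm as [hT heta hal _ hbe _].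
  assert (A0 : 0 <= A) by (specialize (hA 0 ltac:(lra)); lra).
  assert (G0 : 0 <= G) by (specialize (g0 0); lra).
  assert (Cg : forall x, continuous g x) by (intros; now apply unif_cont_continuous).
  set (en := fun n => e0 / INR (S n)).
  assert (Hen : forall n, 0 < en n <= e0).
  { intros n. unfold en. assert (1 <= INR (S n)) by (apply (le_INR 1); lia).
    split; [apply Rdiv_lt_0_compat; lra|]. apply Rle_div_l; [lra|]. nra. }
  set (good := fun n (z : R * R * (R -> R)) => let '(p, q, u) := z in
    delay_eq T (en n) a g p q u /\ 0 <= p /\
    0 <= affine_defect T eta alpha p q /\
    r <= p + affine_defect T eta alpha p q <= r1 /\
    p = beta * Rmax 0 (u eta) /\ u T = alpha * RInt u 0 eta).
  assert (HE : forall n, exists z, good n z).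
  { intros n. destruct (H (en n) (Hen n)) as [p [q [u Hz]]]. now exists (p, q, u). }
  set (z := fun n => proj1_sig (constructive_indefinite_description _ (HE n))).
  assert (Hz : forall n, good n (z n)) by (intros n; unfold z; apply proj2_sig).
  set (p := fun n => fst (fst (z n))). set (q := fun n => snd (fst (z n))).
  set (u := fun n => snd (z n)).
  assert (Hgood : forall n, delay_eq T (en n) a g (p n) (q n) (u n) /\ 0 <= p n /\
    0 <= affine_defect T eta alpha (p n) (q n) /\
    r <= p n + affine_defect T eta alpha (p n) (q n) <= r1 /\
    p n = beta * Rmax 0 (u n eta) /\ u n T = alpha * RInt (u n) 0 eta).
  { intros n. specialize (Hz n). unfold p, q, u. now destruct (z n) as [[? ?] ?]. }
  assert (Cu : forall n x, continuous (u n) x) by (intros n; apply (Hgood n)).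
  assert (Eu : forall n t, 0 <= t <= T ->
     u n t = sol (p n) (q n) (forcing a g (en n) (u n)) t) by (intros n; apply (Hgood n)).
  assert (Ch : forall n x, continuous (forcing a g (en n) (u n)) x)
    by (intros; now apply forcing_continuous).
  assert (Hh : forall n s, 0 <= s <= T -> Rabs (forcing a g (en n) (u n) s) <= A * G).
  { intros n s Hs. specialize (hA s Hs). unfold forcing.
    specialize (g0 (u n (Rmax 0 (s - en n)))).
    rewrite Rabs_pos_eq by nra. apply Rmult_le_compat; lra. }
  assert (Hr1 : 0 <= r1) by (destruct (Hgood 0%nat) as [_ [? [? [? _]]]]; lra).
  assert (Hp : forall n, 0 <= p n <= r1).
  { intros n. destruct (Hgood n) as [_ [? [? [? _]]]]. lra. }
  assert (Hq : forall n, Rabs (q n) <= C * r1).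
  { intros n. destruct (Hgood n) as [_ [? [? [? _]]]].
    destruct (HP (p n) (q n)) as [Hq1 _]; auto.
    eapply Rle_trans; [exact Hq1|]. apply Rmult_le_compat_l; lra. }
  set (L := C * r1 + T * (A * G)).
  assert (HAG : 0 <= A * G) by nra.
  assert (HCr : 0 <= C * r1) by nra.
  assert (HL : 0 <= L) by (unfold L; nra).
  (* The equation controls [u n] only on [[0, T]]; clamping the argument makes the bound and the
     Lipschitz estimate global. *)
  set (v := fun n t => u n (clamp T t)).
  assert (Hlip : forall n s t, Rabs (v n s - v n t) <= L * Rabs (s - t)).
  { intros n s t. unfold v.
    pose proof (clamp_range T s ltac:(lra)). pose proof (clamp_range T t ltac:(lra)).
    rewrite !Eu by auto. eapply Rle_trans.
    - apply sol_lipschitz with (T := T) (m := A * G); auto.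
    - apply Rmult_le_compat; try apply Rabs_pos.
      + pose proof (Rabs_pos (q n)). nra.
      + unfold L. specialize (Hq n). lra.
      + apply clamp_dist. lra. }
  set (B := r1 + C * r1 + L * T).
  assert (HLT : 0 <= L * T) by nra.
  assert (Hv : forall n t, Rabs (v n t) <= B).
  { intros n t. specialize (Hlip n (clamp T t) 0). unfold v in *.
    pose proof (clamp_range T t ltac:(lra)).
    rewrite (clamp_id T (clamp T t)), (clamp_id T 0) in Hlip by lra.
    rewrite (Rabs_pos_eq (clamp T t - 0)) in Hlip by lra.
    rewrite (Eu n 0), sol_0 in Hlip by lra. specialize (Hp n).
    replace (u n (clamp T t)) with ((u n (clamp T t) - p n) + p n) by ring.
    eapply Rle_trans; [apply Rabs_triang|].
    rewrite (Rabs_pos_eq (p n)) by lra. unfold B. nra. }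
  destruct (ascoli_cluster T L B v p q HL Hv Hlip) as [w [p0 [q0 [Hw Hcl]]]].
  { intros n. rewrite Rabs_pos_eq by apply Hp. specialize (Hp n). unfold B. lra. }
  { intros n. specialize (Hq n). unfold B. lra. }
  assert (Cw : forall x, continuous w x) by (intros; now apply lipschitz_continuous with L).
  set (h := fun s => a s * g (w s)).
  assert (Chw : forall x, continuous h x).
  { intros x. apply (continuous_mult a (fun s => g (w s))); auto.
    apply (continuous_comp w g); auto. }
  (* Every condition on the limit is closed, so each is verified up to a multiple of [d] by
     comparison with one such [n]. *)
  assert (Happ : forall d, 0 < d -> exists n,
    Rabs (p n - p0) <= d /\ Rabs (q n - q0) <= d /\
    (forall t, 0 <= t <= T -> Rabs (u n t - w t) <= d) /\
    (forall s, 0 <= s <= T -> Rabs (forcing a g (en n) (u n) s - h s) <= d)).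
  { intros d Hd.
    destruct (hg (d / (A + 1)) ltac:(apply Rdiv_lt_0_compat; lra)) as [d1 [Hd1 Hg1]].
    set (d2 := Rmin d (d1 / 2)).
    assert (Hd2 : 0 < d2) by (apply Rmin_pos; lra).
    assert (Hd2d : d2 <= d) by apply Rmin_l.
    assert (Hd2d1 : d2 <= d1 / 2) by apply Rmin_r.
    (* Shifting the argument by the delay [en n] changes [w] by at most [L * en n]; beyond [N] this
       is below [d1 / 2]. *)
    destruct (INR_unbounded (2 * (L * e0) / d1)) as [N HN].
    destruct (Hcl d2 N Hd2) as [n [Hn [H1 [H2 H3]]]].
    assert (HLe : L * en n < d1 / 2).
    { assert (HnR : INR N < INR (S n)) by (apply lt_INR; lia).
      assert (HSn : 0 < INR (S n)) by (apply lt_0_INR; lia).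
      unfold en. replace (L * (e0 / INR (S n))) with (L * e0 / INR (S n)) by (field; lra).
      apply Rlt_div_l; auto.
      assert (HN' : 2 * (L * e0) < INR N * d1) by (apply Rlt_div_l in HN; lra). nra. }
    assert (H3' : forall t, 0 <= t <= T -> Rabs (u n t - w t) <= d2).
    { intros t Ht. specialize (H3 t Ht). unfold v in H3. now rewrite clamp_id in H3. }
    exists n. repeat split; try lra.
    - intros t Ht. specialize (H3' t Ht). lra.
    - intros s Hs. unfold forcing, h. rewrite <- Rmult_minus_distr_l, Rabs_mult.
      specialize (hA s Hs). rewrite (Rabs_pos_eq (a s)) by lra.
      destruct (Hen n) as [He1 He2].
      assert (Hr := delay_range T (en n) s ltac:(lra) Hs).
      set (s' := Rmax 0 (s - en n)) in *.
      assert (Hss : Rabs (s' - s) <= en n).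
      { unfold s', Rmax. destruct Rle_dec; unfold Rabs; destruct Rcase_abs; lra. }
      assert (HD : Rabs (u n s' - w s) < d1).
      { replace (u n s' - w s) with ((u n s' - w s') + (w s' - w s)) by ring.
        eapply Rle_lt_trans; [apply Rabs_triang|].
        specialize (H3' s' Hr). specialize (Hw s' s).
        assert (L * Rabs (s' - s) <= L * en n) by (apply Rmult_le_compat_l; auto).
        lra. }
      specialize (Hg1 _ _ HD).
      assert (E : (A + 1) * (d / (A + 1)) = d) by (field; lra).
      assert (0 < d / (A + 1)) by (apply Rdiv_lt_0_compat; lra).
      apply Rle_trans with (A * (d / (A + 1))); [|lra].
      apply Rmult_le_compat; try lra. apply Rabs_pos. }
  assert (Hdef : forall n d, Rabs (p n - p0) <= d -> Rabs (q n - q0) <= d ->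
    Rabs (affine_defect T eta alpha (p n) (q n) - affine_defect T eta alpha p0 q0)
      <= (Rabs (1 - alpha * eta) + kappa T eta alpha) * d).
  { intros n d H1 H2. unfold affine_defect.
    replace (_ - _) with ((1 - alpha * eta) * (p n - p0) + kappa T eta alpha * (q n - q0))
      by ring.
    eapply Rle_trans; [apply Rabs_triang|]. rewrite !Rabs_mult.
    rewrite (Rabs_pos_eq (kappa T eta alpha)) by lra.
    pose proof (Rabs_pos (1 - alpha * eta)). nra. }
  set (Kd := Rabs (1 - alpha * eta) + kappa T eta alpha) in *.
  exists p0, q0, w. split; [auto|]. split; [|repeat split].
  - intros t Ht. apply Rminus_diag_uniq.
    apply eq_of_small with (2 + T + T * T). intros d Hd.
    destruct (Happ d Hd) as [n [H1 [H2 [H3 H4]]]].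
    pose proof (sol_dist (p n) (q n) p0 q0 _ h T d t (Ch n) Chw Ht ltac:(lra) H4) as HS.
    rewrite <- Eu in HS by auto. fold h.
    replace (w t - sol p0 q0 h t)
      with (- (u n t - w t) + (u n t - sol p0 q0 h t)) by ring.
    eapply Rle_trans; [apply Rabs_triang|]. rewrite Rabs_Ropp.
    specialize (H3 t Ht). nra.
  - apply Ropp_le_cancel. rewrite Ropp_0. apply le_of_small with 1. intros d Hd.
    destruct (Happ d Hd) as [n [H1 _]]. apply Rabs_le_between in H1.
    specialize (Hp n). lra.
  - apply Ropp_le_cancel. rewrite Ropp_0. apply le_of_small with Kd. intros d Hd.
    destruct (Happ d Hd) as [n [H1 [H2 _]]]. specialize (Hdef n d H1 H2).
    apply Rabs_le_between in Hdef. destruct (Hgood n) as [_ [_ [? _]]]. lra.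
  - apply Rminus_le. apply le_of_small with (1 + Kd). intros d Hd.
    destruct (Happ d Hd) as [n [H1 [H2 _]]]. specialize (Hdef n d H1 H2).
    apply Rabs_le_between in Hdef. apply Rabs_le_between in H1.
    destruct (Hgood n) as [_ [_ [_ [? _]]]]. lra.
  - apply Rminus_le. apply le_of_small with (1 + Kd). intros d Hd.
    destruct (Happ d Hd) as [n [H1 [H2 _]]]. specialize (Hdef n d H1 H2).
    apply Rabs_le_between in Hdef. apply Rabs_le_between in H1.
    destruct (Hgood n) as [_ [_ [_ [? _]]]]. lra.
  - apply Rminus_diag_uniq. apply eq_of_small with (1 + beta). intros d Hd.
    destruct (Happ d Hd) as [n [H1 [_ [H3 _]]]]. specialize (H3 eta ltac:(lra)).
    destruct (Hgood n) as [_ [_ [_ [_ [Hb _]]]]].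
    replace (p0 - beta * Rmax 0 (w eta)) with
      (- (p n - p0) + beta * (Rmax 0 (u n eta) - Rmax 0 (w eta)))
      by (rewrite Hb at 1; ring).
    eapply Rle_trans; [apply Rabs_triang|]. rewrite Rabs_Ropp, Rabs_mult.
    rewrite (Rabs_pos_eq beta) by lra.
    pose proof (Rmax_dist (u n eta) (w eta)).
    assert (beta * Rabs (Rmax 0 (u n eta) - Rmax 0 (w eta)) <= beta * d)
      by (apply Rmult_le_compat_l; lra). lra.
  - apply Rminus_diag_uniq. apply eq_of_small with (1 + alpha * eta). intros d Hd.
    destruct (Happ d Hd) as [n [_ [_ [H3 _]]]].
    destruct (Hgood n) as [_ [_ [_ [_ [_ Hb]]]]].
    replace (w T - alpha * RInt w 0 eta) with
      (- (u n T - w T) + alpha * (RInt (u n) 0 eta - RInt w 0 eta))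
      by (rewrite Hb; ring).
    assert (HI : Rabs (RInt (u n) 0 eta - RInt w 0 eta) <= (eta - 0) * d).
    { apply RInt_dist; auto; [lra|]. intros x Hx. apply H3. lra. }
    eapply Rle_trans; [apply Rabs_triang|]. rewrite Rabs_Ropp, Rabs_mult.
    rewrite (Rabs_pos_eq alpha) by lra. specialize (H3 T ltac:(lra)).
    assert (alpha * Rabs (RInt (u n) 0 eta - RInt w 0 eta) <= alpha * ((eta - 0) * d))
      by (apply Rmult_le_compat_l; lra). lra.
Qed.

(** * Truncation of [f] and strict positivity *)

Lemma unif_cont_clamp (f : R -> R) B : 0 <= B -> (forall x, continuous f x) ->
  unif_cont (fun x => f (clamp B x)).
Proof.
  intros HB Cf e He.
  destruct (Heine f (fun x => 0 <= x <= B) (compact_P3 0 B)) with (eps := mkposreal e He)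
    as [d Hd].
  { intros x _. apply continuity_pt_filterlim. apply Cf. }
  exists d. split; [apply cond_pos|]. intros x y Hxy. apply Rlt_le.
  apply (Hd (clamp B x) (clamp B y)); try now apply clamp_range.
  eapply Rle_lt_trans; [now apply clamp_dist|auto].
Qed.

Lemma bvp_solution (T eta alpha beta e0 A r r1 : R) (a f : R -> R)
  (adm : admissible T eta alpha beta) (he0 : 0 < e0) (hr : 0 < r < r1)
  (Ca : forall x, continuous a x) (hA : forall s, 0 <= s <= T -> 0 <= a s <= A)
  (Cf : forall x, continuous f x) (f0 : forall x, 0 <= f x)
  (fneg : forall x, f (Rmax 0 x) = f x)
  (H : (forall e, 0 < e <= e0 -> no_sub T eta alpha beta e a f r /\
                                 no_super T eta alpha beta e a f r1) \/
       (forall e, 0 < e <= e0 -> no_super T eta alpha beta e a f r /\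
                                 no_sub T eta alpha beta e a f r1)) :
  exists p q h, (forall x, continuous h x) /\
    (forall t, 0 <= t <= T -> h t = a t * f (sol p q h t)) /\
    p = beta * sol p q h eta /\ sol p q h T = alpha * RInt (sol p q h) 0 eta /\
    forall t, 0 < t < T -> 0 < sol p q h t.
Proof.
  destruct (param_bound T eta alpha beta adm) as [C [HC HP]].
  assert (hadm := adm). destruct hadm as [hT heta hal _ hbe _].
  (* Solutions of size at most [r1] stay below [C * r1], so truncating [f] there makes it bounded
     and uniformly continuous without altering the equation for them. Below [0] nothing changes, by
     [fneg]. *)
  set (B := C * r1). assert (HB : 0 <= B) by (unfold B; nra).
  set (g := fun x => f (clamp B x)).
  assert (hg : unif_cont g) by now apply unif_cont_clamp.
  assert (Cg : forall x, continuous g x) by (intros; now apply unif_cont_continuous).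
  destruct (continuity_ab_maj f 0 B HB) as [xm [Hmax _]].
  { intros x _. apply continuity_pt_filterlim. apply Cf. }
  assert (g0 : forall x, 0 <= g x <= f xm).
  { intros x. split; [apply f0|]. apply Hmax. now apply clamp_range. }
  assert (gf : forall x, x <= B -> g x = f x).
  { intros x Hx. unfold g, clamp. rewrite <- (fneg x). f_equal.
    apply Rmin_right. apply Rmax_lub; auto. }
  assert (Htr : forall e p q u, 0 < e <= e0 -> delay_eq T e a g p q u -> 0 <= p ->
     0 <= affine_defect T eta alpha p q -> p + affine_defect T eta alpha p q <= r1 ->
     delay_eq T e a f p q u).
  { intros e p q u He HD Hp Hy Hs.
    destruct (delay_eq_forcing T e a g p q u A ltac:(lra) Ca Cg hA) as [_ [_ Hle]]; auto.
    { intros x. apply g0. }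
    destruct HD as [Cu Eu]. split; auto. intros t Ht. rewrite Eu by auto.
    apply sol_ext; [lra|]. intros s Hs'. unfold forcing. f_equal. apply gf.
    assert (Hr := delay_range T e s ltac:(lra) ltac:(lra)).
    eapply Rle_trans; [now apply Hle|].
    destruct (HP p q Hp Hy) as [_ HP2]. eapply Rle_trans; [now apply HP2|].
    apply Rmult_le_compat_l; lra. }
  assert (Hsub : forall e s, 0 < e <= e0 -> s <= r1 -> no_sub T eta alpha beta e a f s ->
            no_sub T eta alpha beta e a g s).
  { intros e s He Hs HN p q u HD Hp Hy Hpy. apply HN with q; auto.
    apply Htr; auto. lra. }
  assert (Hsup : forall e s, 0 < e <= e0 -> s <= r1 -> no_super T eta alpha beta e a f s ->
            no_super T eta alpha beta e a g s).
  { intros e s He Hs HN p q u HD Hp Hy Hpy. apply HN with q; auto.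
    apply Htr; auto. lra. }
  destruct (delay_limit T eta alpha beta e0 A (f xm) r r1 a g adm he0 Ca hA hg g0)
    as [p [q [u [Cu [Eu [Hp [Hy [Hs [Hb Hint]]]]]]]]].
  { intros e He. apply (delayed_bvp T eta alpha beta e A r r1 a g adm); auto; try lra.
    - intros x. apply g0.
    - destruct H as [H|H]; [left|right]; destruct (H e He); split;
        (apply Hsub || apply Hsup); auto; lra. }
  set (h := fun s => a s * g (u s)) in *.
  assert (Ch : forall x, continuous h x).
  { intros x. apply (continuous_mult a (fun s => g (u s))); auto.
    apply (continuous_comp u g); auto. }
  assert (Hh0 : forall s, 0 <= s <= T -> 0 <= h s).
  { intros s Hs'. apply Rmult_le_pos; [now apply hA|apply g0]. }
  assert (EI : RInt u 0 eta = RInt (sol p q h) 0 eta).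
  { apply (RInt_sol_ext T); auto. lra. }
  rewrite EI, (Eu T) in Hint by lra. rewrite (Eu eta) in Hb by lra.
  assert (Hnn : forall t, 0 <= t <= T -> 0 <= sol p q h t).
  { intros t Ht. apply (super_nonneg T eta alpha beta); auto. lra. }
  rewrite Rmax_right in Hb by (apply Hnn; lra).
  exists p, q, h. split; auto. split; [|split; [auto|split; [auto|]]].
  - intros t Ht. unfold h at 1. rewrite <- (Eu t Ht). f_equal. apply gf.
    rewrite Eu by auto. eapply Rle_trans; [now apply (sol_le p q h T)|].
    destruct (HP p q Hp Hy) as [_ HP2]. eapply Rle_trans; [now apply HP2|].
    apply Rmult_le_compat_l; lra.
  (* An interior zero of a nonnegative concave function spreads to all of [[0, T]] by Harnack; then
     [p = 0] and [q <= 0], contradicting [p + y >= r > 0]. *)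
  - intros t Ht. destruct (Hnn t ltac:(lra)) as [Hlt|Hz]; [auto|exfalso].
    set (c := Rmin t (T - t)).
    assert (Hc : 0 < c) by (apply Rmin_pos; lra).
    assert (Hct : c <= t) by apply Rmin_l. assert (HcT : c <= T - t) by apply Rmin_r.
    assert (Hall : forall s, 0 <= s <= T -> sol p q h s <= 0).
    { intros s Hs'.
      pose proof (concave_harnack T _ c s t (sol_concave p q h T Ch Hh0) Hnn
        ltac:(lra) ltac:(lra) Hs'). rewrite <- Hz in *. nra. }
    assert (Hp0 : p = 0).
    { pose proof (Hall 0 ltac:(lra)) as Hp0. rewrite sol_0 in Hp0. lra. }
    rewrite Hp0 in Hall.
    assert (Hq : q <= 0).
    { apply (sol_nonpos_slope q h T (A * f xm)); auto.
      intros s Hs'. rewrite Rabs_pos_eq by auto. unfold h.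
      specialize (hA s Hs'). specialize (g0 (u s)). apply Rmult_le_compat; lra. }
    pose proof (kappa_pos _ _ _ _ adm). unfold affine_defect in *.
    rewrite Hp0 in *. nra.
Qed.

(** * Extension of the data to the line and growth of [f] *)

Lemma cont_within_comp (D : R -> Prop) (g c : R -> R) x :
  continuous c x -> (forall y, D (c y)) -> cont_within D g (c x) ->
  continuous (fun y => g (c y)) x.
Proof.
  intros Hc HD Hg P HP. specialize (Hg P HP).
  unfold filtermap, within in Hg. specialize (Hc _ Hg).
  unfold filtermap in *. revert Hc. apply filter_imp. intros y Hy. auto.
Qed.

Lemma continuous_cont_within (D : R -> Prop) g x :
  continuous g x -> cont_within D g x.
Proof.
  intros Hg P HP. specialize (Hg P HP). unfold filtermap, within in *.
  revert Hg. apply filter_imp. auto.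
Qed.

Lemma continuous_clamp T x : 0 <= T -> continuous (clamp T) x.
Proof.
  intros HT. apply lipschitz_continuous with 1; [lra|].
  intros s t. pose proof (clamp_dist T s t HT). lra.
Qed.

(** The interval is taken strictly to the left of [t0], so that it keeps a distance from [T] even if
    [t0 = T]. *)
Lemma bump_interval (a : R -> R) t0 : continuous a t0 -> 0 < t0 -> 0 < a t0 ->
  exists c d, 0 < c < d /\ d < t0 /\ forall s, c <= s <= d -> a t0 / 2 <= a s.
Proof.
  intros Ca Ht Ha.
  destruct (proj1 (filterlim_locally a (a t0)) Ca (mkposreal (a t0 / 2) ltac:(lra)))
    as [d Hd].
  set (m := Rmin d t0). assert (Hm : 0 < m) by (apply Rmin_pos; [apply cond_pos|auto]).
  assert (m1 : m <= d) by apply Rmin_l. assert (m2 : m <= t0) by apply Rmin_r.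
  exists (t0 - m / 2), (t0 - m / 4). split; [lra|]. split; [lra|]. intros s Hs.
  assert (Hb : Rabs (a s - a t0) < a t0 / 2).
  { apply Hd. change (Rabs (s - t0) < d). rewrite Rabs_left; lra. }
  apply Rabs_def2 in Hb. lra.
Qed.

Lemma ratio_small_at_0 (f : R -> R) : (forall x, continuous (fun y => f (Rmax 0 y)) x) ->
  filterlim (fun x => f x / x) (at_right 0) (locally 0) ->
  forall eps, 0 < eps -> exists d, 0 < d /\ forall b x, 0 < b < d -> x <= b ->
    f (Rmax 0 x) <= eps * b.
Proof.
  intros Cf Hl eps He.
  destruct (proj1 (filterlim_locally _ 0) Hl (mkposreal eps He)) as [d Hd].
  assert (Hpos : forall x, 0 < x < d -> f x <= eps * x).
  { intros x Hx. specialize (Hd x).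
    assert (Hb : Rabs (f x / x - 0) < eps).
    { apply Hd; [|lra]. change (Rabs (x - 0) < d). rewrite Rabs_pos_eq; lra. }
    apply Rabs_def2 in Hb. apply Rle_div_l; lra. }
  exists d. split; [apply cond_pos|]. intros b x Hb Hx.
  destruct (Rlt_dec 0 x) as [Hx0|Hx0].
  { rewrite Rmax_right by lra. eapply Rle_trans; [apply Hpos; lra|]. nra. }
  (* For [x <= 0] the value is [f 0], about which the ratio says nothing; continuity compares it
     with [f y <= eps * y] at a small [y > 0]. *)
  rewrite Rmax_left by lra. apply le_epsilon. intros n Hn.
  destruct (proj1 (filterlim_locally _ (f (Rmax 0 0))) (Cf 0) (mkposreal n Hn)) as [d1 Hd1].
  set (y := Rmin b (d1 / 2)). pose proof (cond_pos d1).
  assert (Hy : 0 < y) by (apply Rmin_pos; lra).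
  assert (y1 : y <= b) by apply Rmin_l. assert (y2 : y <= d1 / 2) by apply Rmin_r.
  assert (Hc : Rabs (f (Rmax 0 y) - f (Rmax 0 0)) < n).
  { apply Hd1. change (Rabs (y - 0) < d1). rewrite Rabs_pos_eq; lra. }
  rewrite (Rmax_right 0 y), (Rmax_left 0 0) in Hc by lra.
  apply Rabs_def2 in Hc. specialize (Hpos y ltac:(lra)). nra.
Qed.

Lemma ratio_large_at_0 (f : R -> R) : (forall x, 0 <= x -> 0 <= f x) ->
  filterlim (fun x => f x / x) (at_right 0) (Rbar_locally p_infty) ->
  forall M, exists d, 0 < d /\ forall x, 0 <= x < d -> M * x <= f (Rmax 0 x).
Proof.
  intros f0 Hl M.
  destruct (Hl (fun y => M < y)) as [d Hd]; [now exists M|].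
  exists d. split; [apply cond_pos|]. intros x [[Hx|<-] Hxd].
  - rewrite Rmax_right by lra. apply Rle_div_r; [lra|]. apply Rlt_le. apply Hd; auto.
    change (Rabs (x - 0) < d). rewrite Rabs_pos_eq; lra.
  - rewrite Rmax_left by lra. specialize (f0 0 ltac:(lra)). lra.
Qed.

Lemma ratio_large_at_infty (f : R -> R) :
  filterlim (fun x => f x / x) (Rbar_locally p_infty) (Rbar_locally p_infty) ->
  forall M, exists x1, forall x, x1 <= x -> M * x <= f (Rmax 0 x).
Proof.
  intros Hl M.
  destruct (Hl (fun y => M < y)) as [N HN]; [now exists M|].
  exists (Rmax 0 N + 1). intros x Hx.
  pose proof (Rmax_l 0 N). pose proof (Rmax_r 0 N).
  rewrite Rmax_right by lra. apply Rle_div_r; [lra|]. apply Rlt_le. apply HN. lra.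
Qed.

Lemma ratio_small_at_infty (f : R -> R) :
  (forall x, continuous (fun y => f (Rmax 0 y)) x) -> (forall x, 0 <= x -> 0 <= f x) ->
  filterlim (fun x => f x / x) (Rbar_locally p_infty) (locally 0) ->
  forall eps, 0 < eps -> exists b0, 0 < b0 /\ forall b x, b0 < b -> x <= b ->
    f (Rmax 0 x) <= eps * b.
Proof.
  intros Cf f0 Hl eps He.
  destruct (proj1 (filterlim_locally _ 0) Hl (mkposreal eps He)) as [N HN].
  set (N1 := Rmax 0 N + 1).
  assert (HN1 : 0 < N1 /\ N < N1).
  { unfold N1. pose proof (Rmax_l 0 N). pose proof (Rmax_r 0 N). lra. }
  destruct (continuity_ab_maj (fun y => f (Rmax 0 y)) 0 N1) as [xm [Hmax _]]; [lra| |].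
  { intros x _. apply continuity_pt_filterlim. apply Cf. }
  simpl in Hmax. set (F := f (Rmax 0 xm)) in *.
  assert (HF : 0 <= F) by (apply f0, Rmax_l).
  (* As [f] need not be monotone, its maximum [F] on [[0, N1]] must also be below [eps * b]. *)
  exists (N1 + F / eps). assert (0 <= F / eps) by (apply Rle_mult_inv_pos; lra).
  split; [lra|]. intros b x Hb Hx.
  destruct (Rle_dec x N1) as [Hx1|Hx1].
  - apply Rle_trans with F.
    + assert (Hr : 0 <= Rmax 0 x <= N1) by (unfold Rmax; destruct Rle_dec; lra).
      specialize (Hmax _ Hr). rewrite (Rmax_right 0 (Rmax 0 x)) in Hmax by lra. auto.
    + replace F with (eps * (F / eps)) by (field; lra). nra.
  - rewrite Rmax_right by lra.
    assert (HR : Rabs (f x / x - 0) < eps) by (apply HN; lra).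
    apply Rabs_def2 in HR.
    assert (f x <= eps * x) by (apply Rle_div_l; lra). nra.
Qed.

Theorem theorem3p1 (T eta alpha beta : R) (f a : R -> R)
  (hT : 0 < T) (heta : 0 < eta < T)
  (halpha : 0 < alpha < 2 * T / (eta ^ 2))
  (hbeta : 0 <= beta < (2 * T - alpha * eta ^ 2) /
                        (alpha * eta ^ 2 - 2 * eta + 2 * T))
  (hf_cont : forall x, 0 <= x -> cont_within (fun y => 0 <= y) f x)
  (hf_nonneg : forall x, 0 <= x -> 0 <= f x)
  (ha_cont : forall t, 0 <= t <= T -> cont_within (Icc 0 T) a t)
  (ha_nonneg : forall t, 0 <= t <= T -> 0 <= a t)
  (ha_pos : exists t0, eta <= t0 <= T /\ 0 < a t0) :
  ((filterlim (fun x => f x / x) (at_right 0) (locally 0) /\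
    filterlim (fun x => f x / x) (Rbar_locally p_infty) (Rbar_locally p_infty)) ->
   exists u, positive_solution T eta alpha beta a f u) /\
  ((filterlim (fun x => f x / x) (at_right 0) (Rbar_locally p_infty) /\
    filterlim (fun x => f x / x) (Rbar_locally p_infty) (locally 0)) ->
   exists u, positive_solution T eta alpha beta a f u).
Proof.
  assert (adm : admissible T eta alpha beta).
  { replace (eta ^ 2) with (eta * eta) in * by ring.
    destruct halpha as [hal hal']. destruct hbeta as [hbe hbe'].
    apply Rlt_div_r in hal'; [|nra].
    assert (0 < alpha * (eta * eta)) by (apply Rmult_lt_0_compat; nra).
    apply Rlt_div_r in hbe'; [|lra].
    constructor; auto. }
  (* Composing with retractions makes [a] and [f] continuous on the whole line and leaves them
     unchanged where the problem uses them. *)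
  set (ab := fun s => a (clamp T s)).
  set (fb := fun x => f (Rmax 0 x)).
  assert (Cab : forall x, continuous ab x).
  { intros x. apply (cont_within_comp (Icc 0 T) a (clamp T)).
    - apply continuous_clamp. lra.
    - intros y. apply clamp_range. lra.
    - apply ha_cont. apply clamp_range. lra. }
  assert (Cfb : forall x, continuous fb x).
  { intros x. apply (cont_within_comp (fun y => 0 <= y) f (Rmax 0)).
    - apply continuous_Rmax0.
    - intros y. apply Rmax_l.
    - apply hf_cont, Rmax_l. }
  assert (fb0 : forall x, 0 <= fb x) by (intros x; apply hf_nonneg, Rmax_l).
  assert (abE : forall t, 0 <= t <= T -> ab t = a t).
  { intros t Ht. unfold ab. now rewrite clamp_id. }
  destruct (continuity_ab_maj ab 0 T) as [tm [Hmax _]]; [lra| |].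
  { intros x _. apply continuity_pt_filterlim. apply Cab. }
  set (A := ab tm) in *.
  assert (hA : forall s, 0 <= s <= T -> 0 <= ab s <= A).
  { intros s Hs. split; auto. rewrite abE; auto. }
  destruct ha_pos as [t0 [Ht0 Hat0]]. rewrite <- abE in Hat0 by lra.
  destruct (bump_interval ab t0 (Cab t0) ltac:(lra) Hat0) as [c [d [Hcd [Hd Hbump]]]].
  destruct (no_sub_of_small T eta alpha beta A ab adm Cab hA)
    as [C1 [eps [HC1 [Heps Hsub]]]].
  destruct (no_super_of_large T eta alpha beta A (ab t0 / 2) c d ab adm Cab hA Hcd
    ltac:(lra) ltac:(lra) Hbump) as [M [HM Hsup]].
  destruct (Hsup fb Cfb fb0) as [[C2 [HC2 Hsmall]] Hlarge].
  assert (Hfin : (exists r r1, 0 < r < r1 /\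
      ((forall e, 0 < e <= c / 2 -> no_sub T eta alpha beta e ab fb r /\
                                 no_super T eta alpha beta e ab fb r1) \/
       (forall e, 0 < e <= c / 2 -> no_super T eta alpha beta e ab fb r /\
                                 no_sub T eta alpha beta e ab fb r1))) ->
      exists u, positive_solution T eta alpha beta a f u).
  { intros [r [r1 [Hr HN]]].
    destruct (bvp_solution T eta alpha beta (c / 2) A r r1 ab fb adm ltac:(lra) Hr
      Cab hA Cfb fb0) as [p [q [h [Ch [Eh [Hp [Hi Hpos]]]]]]]; auto.
    { intros x. unfold fb. f_equal. apply Rmax_right, Rmax_l. }
    exists (sol p q h), (fun t => q - RInt h 0 t), (fun t => - h t).
    split; [|split; [|split; [|split]]]; auto.
    - split.
      + intros t _. split; [now apply sol_derive|now apply sol_derive2].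
      + intros t _. repeat split; apply continuous_cont_within.
        * now apply sol_continuous.
        * eapply is_derive_continuous. now apply sol_derive2.
        * now apply (continuous_opp h).
    - intros t Ht. rewrite Eh, abE by lra. unfold fb.
      rewrite Rmax_right by (apply Rlt_le; auto). ring.
    - now rewrite sol_0. }
  split; intros [H0 Hinf]; apply Hfin.
  - destruct (ratio_small_at_0 f Cfb H0 (eps / C1)) as [del [Hdel Hs]];
      [apply Rdiv_lt_0_compat; lra|].
    destruct (ratio_large_at_infty f Hinf M) as [x1 Hx1].
    destruct (Hlarge x1 Hx1) as [S HS].
    (* [C1 * r = del / 2] lies in the range where the ratio is below [eps / C1], and
       [(eps / C1) * (C1 * r)] is the bound [eps * r] required. *)
    set (r := del / (2 * C1)).
    assert (Hr : 0 < r) by (apply Rdiv_lt_0_compat; lra).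
    assert (HCr : C1 * r = del / 2) by (unfold r; field; lra).
    exists r, (Rmax r S + 1). pose proof (Rmax_l r S). pose proof (Rmax_r r S).
    split; [lra|]. left. intros e He. split; [|apply HS; lra].
    apply Hsub; auto; [lra|]. intros x Hx.
    replace (eps * r) with (eps / C1 * (C1 * r)) by (field; lra).
    apply Hs; [|lra]. lra.
  - destruct (ratio_large_at_0 f hf_nonneg H0 M) as [del [Hdel Hs]].
    destruct (ratio_small_at_infty f Cfb hf_nonneg Hinf (eps / C1)) as [b0 [Hb0 Hb]];
      [apply Rdiv_lt_0_compat; lra|].
    set (r := del / (2 * C2)).
    assert (Hr : 0 < r) by (apply Rdiv_lt_0_compat; lra).
    assert (HCr : C2 * r = del / 2) by (unfold r; field; lra).
    (* Large enough for both [r < r1] and [b0 < C1 * r1]. *)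
    set (r1 := r + b0 / C1 + 1).
    assert (Hbc : 0 < b0 / C1) by (apply Rdiv_lt_0_compat; lra).
    exists r, r1. split; [unfold r1; lra|]. right. intros e He. split.
    + apply Hsmall; auto. intros x Hx. apply Hs. lra.
    + apply Hsub; auto; [lra|unfold r1; lra|]. intros x Hx.
      replace (eps * r1) with (eps / C1 * (C1 * r1)) by (field; lra).
      apply Hb; auto.
      assert (E : C1 * (b0 / C1) = b0) by (field; lra). unfold r1. nra.
Qed.
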